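(* Let $\Pi:\tilde Q\to Q$ be a Riemannian submersion, let $q(t)\in Q$ be a Riemannian cubic, and let $\tilde q(t)\in\tilde Q$ be a horizontal lift of $q(t)$. The curve $\tilde q(t)$ is a Riemannian cubic if and only if $$\left[\dot{\tilde q},\frac{D}{Dt}\dot{\tilde q}\right]^V=0\quad\text{for all }t,$$ where the superscript $V$ denotes the vertical part.
   Context: Riemannian cubic: a curve $q(t)$ in a Riemannian manifold satisfying $\frac{D^3}{Dt^3}\dot q+R\big(\frac{D}{Dt}\dot q,\dot q\big)\dot q=0$, where $\frac{D}{Dt}$ is the Levi-Civita covariant derivative along the curve and $R(X,Y)Z=\nabla_X\nabla_YZ-\nabla_Y\nabla_XZ-\nabla_{[X,Y]}Z$. For the Riemannian submersion $\Pi$, the vertical space at $\tilde q\in\tilde Q$ is $\ker T_{\tilde q}\Pi$ and the horizontal space $T^H_{\tilde q}\tilde Q$ is its orthogonal complement. A horizontal lift of $q(t)$ is a curve $\tilde q(t)$ with $\Pi(\tilde q(t))=q(t)$ and horizontal velocity; for such a curve $\frac{D}{Dt}\dot{\tilde q}$ (Levi-Civita connection of $\tilde Q$) is horizontal. For horizontal vectors $\tilde v,\tilde w\in T^H_{\tilde q}\tilde Q$, one defines $[\tilde v,\tilde w]^V:=[\tilde V,\tilde W]^V(\tilde q)$, where $\tilde V,\tilde W$ are any extensions of $\tilde v,\tilde w$ to horizontal vector fields (the result does not depend on the extensions). *)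

(* Defs.v *)
(* Smooth manifolds are set up from atlases, and the objects
   of Riemannian geometry through their components in the charts. *)
From HB Require Import structures.
From mathcomp Require Import all_boot all_order all_algebra.
From mathcomp Require Import all_classical all_reals all_analysis.
Import Order.TTheory GRing.Theory Num.Theory numFieldNormedType.Exports.

Set Implicit Arguments.
Unset Strict Implicit.
Unset Printing Implicit Defensive.

Local Open Scope classical_set_scope.
Local Open Scope ring_scope.

(* C^k and C^oo maps on an open set U of a finite-dimensional space; only the
   germs of f at the points of U matter. *)
Fixpoint Ck_on {R : realType} {V W : normedModType R} (k : nat) (U : set V)
    (f : V -> W) : Prop :=
  (forall x, U x -> {for x, continuous f}) /\
  if k is k'.+1 then
    forall v : V, (forall x, U x -> derivable f x v) /\
      Ck_on k' U (fun x => 'D_v f x)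
  else True.

Definition smooth_on {R : realType} {V W : normedModType R} (U : set V)
  (f : V -> W) : Prop := forall k, Ck_on k U f.

(* Smooth n-manifolds without boundary; the charts are the maps
   phi i : dom i -> phi i (dom i), with inverse psi i. *)
Record manifold (R : realType) (n : nat) := Manifold {
  carrier :> topologicalType ;
  manifold_hausdorff : hausdorff_space carrier ;
  manifold_second_countable : @second_countable carrier ;
  chart : Type ;
  dom : chart -> set carrier ;
  phi : chart -> carrier -> 'rV[R]_n ;
  psi : chart -> 'rV[R]_n -> carrier ;
  dom_open : forall i, open (dom i) ;
  cod_open : forall i, open (phi i @` dom i) ;
  phiK : forall i p, dom i p -> psi i (phi i p) = p ;
  phi_continuous : forall i p, dom i p -> {for p, continuous (phi i)} ;
  psi_continuous : forall i x, (phi i @` dom i) x -> {for x, continuous (psi i)} ;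
  chart_cover : forall p, exists i, dom i p ;
  transition_smooth : forall i j,
    smooth_on (phi i @` (dom i `&` dom j)) (phi j \o psi i)
}.

Section Manifold.
Context {R : realType} {n : nat} {M : manifold R n}.
Implicit Types (i j : chart M) (p : M).

Definition chart_at p : chart M := projT1 (cid (chart_cover p)).

(* A tangent vector at p is the family of its components in all the charts
   around p; the components in the other charts are set to 0, so that equality
   of tangent vectors is equality of families. *)
Definition tvec : Type := chart M -> 'rV[R]_n.

Definition tangent p (v : tvec) : Prop :=
  (forall i, ~ dom i p -> v i = 0) /\
  (forall i j, dom i p -> dom j p ->
     v j = 'D_(v i) (phi j \o psi i) (phi i p)).

Definition at_point p (c : tvec) : tvec :=
  fun i => if `[< dom i p >] then c i else 0.

Definition tvec_of i (u : 'rV[R]_n) p : tvec :=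
  at_point p (fun j => 'D_u (phi j \o psi i) (phi i p)).

(* X is a smooth vector field on the open set U. *)
Definition smooth_field (U : set M) (X : M -> tvec) : Prop :=
  (forall p, U p -> tangent p (X p)) /\
  (forall i, smooth_on (phi i @` (dom i `&` U)) (fun x => X (psi i x) i)).

Definition smooth_curve (I : set R) (q : R -> M) : Prop :=
  (forall t, I t -> {for t, continuous q}) /\
  (forall i, smooth_on (I `&` q @^-1` dom i) (phi i \o q)).

Definition velocity (q : R -> M) (t : R) : tvec :=
  at_point (q t) (fun i => derive1 (phi i \o q) t).

End Manifold.
Arguments tvec {R n} M.

(* Lie bracket of vector fields on an open subset of R^n. *)
Definition lie_coord {R : realType} {n : nat} (X Y : 'rV[R]_n -> 'rV[R]_n)
  (x : 'rV[R]_n) : 'rV[R]_n := 'D_(X x) Y x - 'D_(Y x) X x.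

Definition lie {R : realType} {n : nat} {M : manifold R n}
    (X Y : M -> tvec M) (p : M) : tvec M :=
  at_point p (fun i =>
    lie_coord (fun x => X (psi i x) i) (fun x => Y (psi i x) i) (phi i p)).

Definition smooth_map {R : realType} {m n : nat} {M : manifold R m}
    {N : manifold R n} (f : M -> N) : Prop :=
  continuous f /\
  (forall i j, smooth_on (phi i @` (dom i `&` f @^-1` dom j))
     (phi j \o f \o psi i)).

(* The tangent map T_p f, read from a chart around p into all the charts around
   f p. *)
Definition tangent_map {R : realType} {m n : nat} {M : manifold R m}
    {N : manifold R n} (f : M -> N) (p : M) (v : tvec M) : tvec N :=
  let i := chart_at p in
  at_point (f p) (fun j => 'D_(v i) (phi j \o f \o psi i) (phi i p)).

Definition gram_of {R : realType} {n : nat} {M : manifold R n}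
    (g : M -> tvec M -> tvec M -> R) (i : chart M) (x : 'rV[R]_n) : 'M[R]_n :=
  let p := psi i x in
  \matrix_(a, b)
    g p (tvec_of i (delta_mx ord0 a) p) (tvec_of i (delta_mx ord0 b) p).

Record riemannian (R : realType) (n : nat) := Riemannian {
  base :> manifold R n ;
  metric : base -> tvec base -> tvec base -> R ;
  metric_linear : forall p (c : R) u v w,
    tangent p u -> tangent p v -> tangent p w ->
    metric p (fun i => c *: u i + v i) w = c * metric p u w + metric p v w ;
  metric_sym : forall p u v, tangent p u -> tangent p v ->
    metric p u v = metric p v u ;
  metric_pos : forall p u, tangent p u -> u <> (fun=> 0) -> 0 < metric p u u ;
  metric_smooth : forall i a b,
    smooth_on (phi i @` dom i) (fun x => gram_of metric i x a b)
}.

Section Riemannian.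
Context {R : realType} {n : nat} {M : riemannian R n}.
Implicit Types (i : chart M) (p : M).

Definition gram i : 'rV[R]_n -> 'M[R]_n := gram_of (@metric R n M) i.

Definition dgram i (x : 'rV[R]_n) (l a b : 'I_n) : R :=
  'D_(delta_mx ord0 l) (fun y => gram i y a b) x.

(* Christoffel symbols Gamma^k_{ab} of the Levi-Civita connection. *)
Definition christoffel i (x : 'rV[R]_n) (k a b : 'I_n) : R :=
  2^-1 * \sum_l invmx (gram i x) k l *
    (dgram i x a b l + dgram i x b a l - dgram i x l a b).

Definition christoffel_form i (x u v : 'rV[R]_n) : 'rV[R]_n :=
  \row_k \sum_a \sum_b christoffel i x k a b * u ord0 a * v ord0 b.

(* The Levi-Civita connection on vector fields, in the chart i. *)
Definition nabla i (X Y : 'rV[R]_n -> 'rV[R]_n) (x : 'rV[R]_n) : 'rV[R]_n :=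
  'D_(X x) Y x + christoffel_form i x (X x) (Y x).

Definition curvature_field i (X Y Z : 'rV[R]_n -> 'rV[R]_n) (x : 'rV[R]_n)
    : 'rV[R]_n :=
  nabla i X (nabla i Y Z) x - nabla i Y (nabla i X Z) x
  - nabla i (lie_coord X Y) Z x.

(* R(u, v)w at p: by tensoriality any extensions of u, v, w can be used; here,
   in each chart, those with constant components. *)
Definition curvature p (u v w : tvec M) : tvec M :=
  at_point p (fun i =>
    curvature_field i (fun=> u i) (fun=> v i) (fun=> w i) (phi i p)).

(* The covariant derivative DV/Dt of a vector field V along the curve q. *)
Definition covD (q : R -> M) (V : R -> tvec M) (t : R) : tvec M :=
  at_point (q t) (fun i =>
    derive1 (fun s => V s i) t
    + christoffel_form i (phi i (q t)) (velocity q t i) (V t i)).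

Definition riemannian_cubic (I : set R) (q : R -> M) : Prop :=
  smooth_curve I q /\
  forall t, I t ->
    iter 3 (covD q) (velocity q) t
    + curvature (q t) (covD q (velocity q) t) (velocity q t) (velocity q t)
    = 0.

End Riemannian.

Section Submersion.
Context {R : realType} {m n : nat} {M : riemannian R m} {N : riemannian R n}.
Variable Pi : M -> N.
Implicit Types (p : M) (u v w z : tvec M).

Definition vertical p v : Prop := tangent p v /\ tangent_map Pi p v = 0.

Definition horizontal p v : Prop :=
  tangent p v /\ forall w, vertical p w -> metric p v w = 0.

Definition riemannian_submersion : Prop :=
  [/\ smooth_map Pi,
      forall p (w : tvec N), tangent (Pi p) w ->
        exists2 v, tangent p v & tangent_map Pi p v = w
    & forall p u v, horizontal p u -> horizontal p v ->
        metric (Pi p) (tangent_map Pi p u) (tangent_map Pi p v)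
        = metric p u v].

Definition horizontal_lift (I : set R) (q : R -> N) (qt : R -> M) : Prop :=
  [/\ smooth_curve I qt,
      forall t, I t -> Pi (qt t) = q t
    & forall t, I t -> horizontal (qt t) (velocity qt t)].

(* The component of z in the decomposition of T_p M as the orthogonal direct
   sum of the vertical and horizontal spaces. *)
Definition vertical_part p z : tvec M :=
  xget 0 [set w : tvec M | vertical p w /\ horizontal p (z - w)].

Definition horizontal_extension p v (U : set M) (X : M -> tvec M) : Prop :=
  [/\ open U, U p, smooth_field U X,
      forall p', U p' -> horizontal p' (X p')
    & X p = v].

(* [v, w]^V for v, w horizontal at p, through any extensions to horizontal
   vector fields on a neighbourhood of p. *)
Definition vertical_bracket p v w : tvec M :=
  xget 0 [set z : tvec M | exists U X Y,
    [/\ horizontal_extension p v U X, horizontal_extension p w U Y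
      & z = vertical_part p (lie X Y p)]].

End Submersion.

(* Main.v *)
(* Everything is computed in one chart around qt(t) and one chart around q(t), in
   which Pi becomes a map F between open sets of vector spaces.  Let B = nabla dF
   be its second fundamental form and om(u,v,w) = <B(u,v), dF w>.
   Differentiating <V, z> = <dF V, dF z> for a horizontal field V along a curve x
   gives om(x',V,z) + om(x',z,V) = <D_t V, z> - <dF D_t V, dF z>.  Hence om(u,h,k)
   is antisymmetric in horizontal h, k, so that B(h,k) = 0 and D_t commutes with
   dF on horizontal fields along horizontal curves; moreover, for vertical z,
   <D_t V, z> = om(x',z,V), and <[v,w]^V, z> = 2 om(z,v,w).
   Put v = qt', a = D_t v, b = D_t a and T = D_t b + R(a,v)v.  The Codazzi equation
   for B yields dF T = (the cubic equation of q) - 4 B(b,v), and pairing with dF a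
   gives -4 |b^V|^2, where <b^V, z> = om(v,z,a).  So T = 0 forces b^V = 0, that is
   [v,a]^V = 0.  Conversely, if om(z,v,a) = 0 for all vertical z along the curve,
   then b is horizontal and dF T = 0; differentiating om(a,z,v) = 0 along qt, and
   om(V,z,V) = 0 in the direction a, gives <T, z> = 0 by the Codazzi equation. *)
Require Import Defs.
From HB Require Import structures.
From mathcomp Require Import all_boot all_order all_algebra.
From mathcomp Require Import all_classical all_reals all_analysis.
From mathcomp Require Import ring lra.
Import Order.TTheory GRing.Theory Num.Theory numFieldNormedType.Exports.

Set Implicit Arguments.
Unset Strict Implicit.
Unset Printing Implicit Defensive.

Local Open Scope classical_set_scope.
Local Open Scope ring_scope.

(** * Calculus of C^k maps *)

(** The obstacle is that b need not be horizontal, so the projected equation carries an error term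
    in B. Its coefficient 4 is 1 + 2 + 1: differentiating dF b along the curve contributes B(v,b),
    and the Codazzi equation contributes (nabla_a B)(v,v) = 2 B(b,v) minus (nabla_v B)(a,v) =
    -B(b,v). The first of these is a derivative in the direction a, in which the curve provides no
    field; v is therefore extended horizontally along a straight line of the chart. Since B is a
    tensor with components in the charts, the curvature argument needs extensions along curves only;
    horizontal fields on open sets enter through the Lie bracket alone. The forward direction is
    pointwise in t, whereas the converse differentiates the bracket condition and so needs it near
    t. Chart independence comes from the same lemmas: a transition map is an isometry, every vector
    is horizontal for it, and its B vanishes. As C^k is phrased with directional derivatives,
    Frechet differentiability and the chain rule have to be established before any of this. *)

Section DirectionalDerivatives.
Context {R : realType}.
Implicit Types (V W : normedModType R).

(** Only the outer map has to be Frechet differentiable. The inner one is restricted to the line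
    through [x] in direction [v], where derivability and differentiability coincide, and the usual
    chain rule applies there. *)
Lemma is_derive_comp_diff V1 V W (f : V1 -> V) (g : V -> W) x v df :
  is_derive x v f df -> differentiable g (f x) ->
  is_derive x v (g \o f) ('D_df g (f x)).
Proof.
move=> [dfx <-] dg.
have d1 : differentiable (fun h : R => f (h *: v + x)) 0.
  by apply/derivable1_diffP; exact: (derivable1P _ _ _).1.
have fx0 : f (0 *: v + x) = f x by rewrite scale0r add0r.
have dg' : differentiable g (f (0 *: v + x)) by rewrite fx0.
have d2 : differentiable (g \o (fun h : R => f (h *: v + x))) 0.
  exact: differentiable_comp.
have e1 (U : normedModType R) (k : V1 -> U) : 'D_v k x = 'D_1 (fun h : R => k (h *: v + x)) 0.
  rewrite /derive (_ : (fun h : R => h^-1 *: (((fun h : R => k (h *: v + x)) \o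
      shift 0) (h *: 1) - k (0 *: v + x))) =
    (fun h : R => h^-1 *: ((k \o shift x) (h *: v) - k x)))//.
  by apply/funext => h /=; rewrite addr0 scale0r add0r [_%:A]mulr1.
apply: DeriveDef.
  by apply/(derivable1P _ _ _).2/derivable1_diffP.
rewrite e1 deriveE// (@diff_comp _ _ _ _ (fun h : R => f (h *: v + x)) g)//=.
by rewrite fx0 (e1 _ f) (deriveE _ d1) deriveE.
Qed.

Lemma is_derive_line V W (f : V -> W) x v (s : R) df :
  is_derive (x + s *: v) v f df -> is_derive (s : R) 1 (fun h : R => f (x + h *: v)) df.
Proof.
have e : (fun h => h^-1 *: (((fun h : R => f (x + h *: v)) \o shift s) (h *: 1) -
          f (x + s *: v))) =
         (fun h => h^-1 *: ((f \o shift (x + s *: v)) (h *: v) -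
          f (x + s *: v))).
  apply/funext => h /=; rewrite [h *: 1]mulr1 scalerDl.
  by congr (_ *: (f _ - _)); rewrite addrCA.
by case=> df1 df2; apply: DeriveDef; rewrite ?/derivable ?/derive e.
Qed.

(** The line in direction [c *: v] is the line in direction [v] reparametrized by h |-> h c, so the
    chain rule applies; [c = 0] needs no separate case. *)
Lemma derive_scale_dir V W (f : V -> W) x v c : derivable f x v ->
  is_derive x (c *: v) f (c *: 'D_v f x).
Proof.
move=> dfv.
have d0 : is_derive (0 : R) 1 (fun h : R => f (x + h *: v)) ('D_v f x).
  apply: is_derive_line; rewrite scale0r addr0; exact: derivableP.
have dd : differentiable (fun h : R => f (x + h *: v)) 0.
  by apply/derivable1_diffP; case: d0.
have dc : is_derive (0 : R) 1 (fun h : R => h * c) c.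
  have -> : (fun h : R => h * c) = ( *:%R^~ c) by apply/funext.
  apply: DeriveDef; first exact: diff_derivable.
  by rewrite deriveE// diff_val scale1r.
have := @is_derive_comp_diff _ _ _ (fun h : R => h * c)
   (fun h : R => f (x + h *: v)) 0 1 c dc.
rewrite mul0r => /(_ dd) [h1 h2].
have e1 : 'D_c (fun h : R => f (x + h *: v)) 0 = c *: 'D_v f x.
  rewrite deriveE// -[c in LHS]mulr1 [LHS]linearZ/=.
  by case: d0 => _ <-; rewrite deriveE.
have e (U : normedModType R) (k : V -> U) :
  (fun h => h^-1 *: ((k \o shift x) (h *: (c *: v)) - k x)) =
  (fun h => h^-1 *: ((((fun h : R => k (x + h *: v)) \o (fun h : R => h * c)) \o shift 0)
     (h *: 1) - ((fun h : R => k (x + h *: v)) \o (fun h : R => h * c)) 0)).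
  apply/funext => h /=; rewrite [h *: 1]mulr1 addr0 mul0r scale0r addr0.
  by rewrite scalerA (addrC x).
apply: DeriveDef; rewrite ?/derivable ?/derive e//.
by rewrite -e1 -h2.
Qed.

Lemma mvt_dir V (f : V -> R) x v :
  (forall s : R, 0 <= s <= 1 -> derivable f (x + s *: v) v) ->
  exists2 s, 0 < s < 1 & f (x + v) - f x = 'D_v f (x + s *: v).
Proof.
move=> dfv.
pose k (h : R) := f (x + h *: v).
have dk (s : R) : 0 <= s <= 1 -> is_derive s 1 k ('D_v f (x + s *: v)).
  by move=> s01; apply: is_derive_line; exact/derivableP/dfv.
have [||c] := @MVT R k (fun s => 'D_v f (x + s *: v)) 0 1 ltr01.
- move=> s /[!in_itv]/= /andP[s0 s1]; apply: dk; by rewrite !ltW.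
- apply: derivable_within_continuous => s /[!in_itv]/= s01.
  by case: (dk s s01).
rewrite in_itv/= => c01; rewrite /k scale1r scale0r addr0 subr0 mulr1 => e.
by exists c.
Qed.

Lemma near0_ball V (P : set V) x : (\forall y \near x, P y) ->
  exists2 d : R, 0 < d & forall h, `|h| < d -> P (x + h).
Proof.
move=> /nbhs_ballP[d /= d0 dP]; exists d => // h hd; apply: dP.
by rewrite -ball_normE /= opprD addrA subrr add0r normrN.
Qed.

(** The increment along [v + w] is split at the corner x + h v. The leg along [v] gives the
    derivative at [x]; the leg along [w] starts from a moving point, so the mean value theorem and
    the continuity of ['D_w f] are needed. *)
Lemma is_deriveD_dir V (f : V -> R) x v w :
  (\forall y \near x, derivable f y w) -> derivable f x v ->
  {for x, continuous ('D_w f)} ->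
  is_derive x (v + w) f ('D_v f x + 'D_w f x).
Proof.
move=> dw dv cw.
suff H : (fun h => h^-1 *: ((f \o shift x) (h *: (v + w)) - f x)) @ 0^' -->
   'D_v f x + 'D_w f x.
  apply: DeriveDef; first by apply/cvg_ex; exists ('D_v f x + 'D_w f x).
  exact/cvg_lim.
have -> : (fun h => h^-1 *: ((f \o shift x) (h *: (v + w)) - f x)) =
  (fun h => h^-1 *: ((f \o shift x) (h *: v) - f x)) +
  (fun h => h^-1 *: (f (x + h *: v + h *: w) - f (x + h *: v))).
  apply/funext => h /=; rewrite -[RHS]/(_ + _) -scalerDr; congr (_ *: _).
  rewrite scalerDr ![_ + x]addrC addrA.
  by rewrite [RHS]addrC addrA subrK.
apply: cvgD; first exact: dv.
apply/cvgrPdist_le => e e0.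
have [d d0 dP] : exists2 d : R, 0 < d & forall h, `|h| < d ->
    derivable f (x + h) w /\ `|'D_w f x - 'D_w f (x + h)| <= e.
  apply: (@near0_ball _ (fun y => derivable f y w /\ `|'D_w f x - 'D_w f y| <= e)).
  near=> y; split; first by near: y.
  near: y; exact: (cvgrPdist_le _ _).1 cw e e0.
(* The bound |h| < d / M keeps the two-leg path inside the ball of radius d; the summand 1 makes M
   positive even when both directions vanish. *)
pose M := `|v| + `|w| + 1.
have M0 : 0 < M by rewrite ltr_wpDl// addr_ge0.
have small (h s : R) : `|h| < d / M -> 0 <= s <= 1 -> `|h *: v + s *: (h *: w)| < d.
  move=> hM /andP[s0 s1]; rewrite scalerA mulrC -scalerA -scalerDr normrZ.
  apply: (@le_lt_trans _ _ (`|h| * M)); last by rewrite -ltr_pdivlMr.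
  rewrite ler_wpM2l//; apply: (le_trans (ler_normD _ _)).
  rewrite /M -addrA lerD2l normrZ ger0_norm//.
  by rewrite -[leLHS]addr0 lerD// ler_piMl.
near=> h.
have h0 : h != 0 by near: h; exact: nbhs_dnbhs_neq.
have hd : `|h| < d / M by near: h; apply: dnbhs0_lt; rewrite divr_gt0.
have [|s s01 ->] := @mvt_dir _ f (x + h *: v) (h *: w).
  move=> s s01; have [] := dP (h *: v + s *: (h *: w)) (small _ _ hd s01).
  rewrite addrA => dd _.
  by have [] := derive_scale_dir h dd.
have s01' : 0 <= s <= 1 by case/andP: s01 => ? ?; rewrite !ltW.
have [dd le] := dP (h *: v + s *: (h *: w)) (small _ _ hd s01').
rewrite addrA in dd le; have [_ ->] := derive_scale_dir h dd.
by rewrite scalerA mulVf// scale1r.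
Unshelve. all: by end_near. Qed.

End DirectionalDerivatives.

(** * Frechet differentiability of C^1 maps and symmetry of second derivatives *)

Section FiniteDimensional.
Context {R : realType}.

Lemma row_sum m (v : 'rV[R]_m) : v = \sum_a v ord0 a *: delta_mx ord0 a.
Proof. exact: row_sum_delta. Qed.

Lemma rV_entry_le m (v : 'rV[R]_m) a : `|v ord0 a| <= `|v|.
Proof.
rewrite [leRHS]/Num.Def.normr/= mx_normrE.
by apply: le_trans (le_bigmax _ _ (ord0, a)).
Qed.

Lemma differentiable_expansion (V W : normedModType R) (f : V -> W)
    (df : {linear V -> W}) x : continuous df ->
  (forall e : R, 0 < e ->
     \forall h \near 0, `|f (x + h) - f x - df h| <= e * `|h|) ->
  differentiable f x.
Proof.
move=> cdf hf.
have ex : f \o shift x = cst (f x) + df +o_ 0 id.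
  apply/eqaddoP => _/posnumP[e].
  have := hf e%:num [gt0 of e%:num].
  apply: filterS => h /=.
  by rewrite -[X in _ -> `|X| <= _]/(f (h + x) - (f x + df h)) opprD addrA (addrC h).
apply/diff_locallyP; rewrite (diff_unique cdf ex).
by split.
Qed.

(** [Ck_on] speaks of each direction separately, so linearity in the direction is a theorem; it
    comes from the continuity of the directional derivatives. *)
Lemma derive_linear_C1 m (f : 'rV[R]_m -> R) (U : set 'rV[R]_m) x :
  open U -> U x -> Ck_on 1 U f ->
  forall c u v, 'D_(c *: u + v) f x = c *: 'D_u f x + 'D_v f x.
Proof.
move=> oU Ux [_ h] c u v.
have [h1 h2] := derive_scale_dir c ((h u).1 x Ux).
have [_ ->] : is_derive x (c *: u + v) f ('D_(c *: u) f x + 'D_v f x).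
  apply: is_deriveD_dir h1 _; last exact: (h v).2.1.
  near=> y; apply: (h v).1; near: y; exact: open_nbhs_nbhs.
by rewrite h2.
Unshelve. all: by end_near. Qed.

Lemma derive_sum_C1 m (f : 'rV[R]_m -> R) (U : set 'rV[R]_m) x :
  open U -> U x -> Ck_on 1 U f ->
  forall v, 'D_v f x = \sum_a v ord0 a * 'D_(delta_mx ord0 a) f x.
Proof.
move=> oU Ux hf v; have L := derive_linear_C1 oU Ux hf.
pose g := GRing.isLinear.Build R _ _ _ (fun v => 'D_v f x) (fun c u v => L c u v).
pose G : {linear 'rV[R]_m -> R^o} := HB.pack (fun v => 'D_v f x : R^o) g.
have -> : 'D_v f x = G v by [].
rewrite {1}(row_sum v) linear_sum; apply: eq_bigr => a _.
by rewrite linearZ.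
Qed.

(** On the segment from x to x + h the increment equals ['D_h f] at an intermediate point. Expanded
    in the basis, its difference to ['D_h f x] is controlled by the continuity of the partial
    derivatives. *)
Lemma differentiable_C1 m (f : 'rV[R]_m -> R) (U : set 'rV[R]_m) x :
  open U -> U x -> Ck_on 1 U f -> differentiable f x.
Proof.
move=> oU Ux hf; have L := derive_linear_C1 oU Ux hf.
pose g := GRing.isLinear.Build R _ _ _ (fun v => 'D_v f x) (fun c u v => L c u v).
pose G : {linear 'rV[R]_m -> R^o} := HB.pack (fun v => 'D_v f x : R^o) g.
have GE v : G v = \sum_a v ord0 a * 'D_(delta_mx ord0 a) f x.
  exact: derive_sum_C1 hf v.
apply: (@differentiable_expansion _ _ f G) => [v|e e0].
  have -> : (G : 'rV[R]_m -> R) =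
      (fun v => \sum_a v ord0 a * 'D_(delta_mx ord0 a) f x).
    exact/funext.
  apply: differentiable_continuous.
  have -> : (fun v : 'rV[R]_m => \sum_a v ord0 a * 'D_(delta_mx ord0 a) f x) =
     \sum_a (fun v : 'rV[R]_m => v ord0 a * 'D_(delta_mx ord0 a) f x).
    by apply/funext => w; rewrite fct_sumE.
  apply: differentiable_sum => a.
  apply: differentiableM; first exact: differentiable_coord.
  exact: differentiable_cst.
(* Each of the m partial derivatives may be off by e / (m + 1), so the total error is at most e
   times the norm of h; m + 1 instead of m avoids a division by zero when m = 0. *)
have [d d0 dP] : exists2 d : R, 0 < d & forall h, `|h| < d -> U (x + h) /\
    forall a, `|'D_(delta_mx ord0 a) f x - 'D_(delta_mx ord0 a) f (x + h)|
       <= e / (m.+1)%:R.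
  apply: (@near0_ball _ _ (fun y => U y /\ forall a,
    `|'D_(delta_mx ord0 a) f x - 'D_(delta_mx ord0 a) f y| <= e / (m.+1)%:R)).
  near=> y; split; first by near: y; exact: open_nbhs_nbhs.
  near: y; apply: filter_forall => a.
  have [_ /(_ (delta_mx ord0 a))[_ [c _]]] := hf.
  apply: (cvgrPdist_le _ _).1; first exact: c.
  by rewrite divr_gt0.
near=> h.
have hd : `|h| < d by near: h; exact: (@nbhs0_lt R 'rV[R]_m).
have sd (s : R) : 0 <= s <= 1 -> `|s *: h| < d.
  move=> /andP[s0 s1]; rewrite normrZ ger0_norm//.
  by apply: le_lt_trans hd; rewrite ler_piMl.
have [|s /andP[s0 s1] ->] := @mvt_dir _ _ f x h.
  move=> s s01; have [Uy _] := dP _ (sd s s01).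
  exact: (hf.2 h).1.
have s01 : 0 <= s <= 1 by rewrite !ltW.
have [Uy dist] := dP _ (sd s s01).
rewrite GE (derive_sum_C1 oU Uy hf) -sumrB.
apply: (le_trans (ler_norm_sum _ _ _)).
apply: (@le_trans _ _ (\sum_(a < m) (`|h| * (e / (m.+1)%:R)))).
  apply: ler_sum => a _; rewrite -mulrBr normrM ler_pM//.
    exact: rV_entry_le.
  by rewrite distrC.
rewrite sumr_const card_ord -[_ *+ m]mulr_natr -mulrA mulrC ler_wpM2r//.
rewrite -mulrA ler_piMr ?(ltW e0)// mulrC ler_pdivrMr// mul1r.
by rewrite ler_nat.
Unshelve. all: by end_near. Qed.

Lemma derive_comm_C2 (V : normedModType R) (f : V -> R) (U : set V) x u v :
  open U -> U x -> (forall y, U y -> derivable f y u) ->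
  (forall y, U y -> derivable f y v) ->
  (forall y, U y -> derivable ('D_u f) y v) ->
  (forall y, U y -> derivable ('D_v f) y u) ->
  {for x, continuous ('D_v ('D_u f))} -> {for x, continuous ('D_u ('D_v f))} ->
  'D_v ('D_u f) x = 'D_u ('D_v f) x.
Proof.
move=> oU Ux fu fv fuv fvu cuv cvu.
(* The second difference quotient tends to either mixed derivative. *)
have key (a b : V) (e : R) : 0 < e ->
    (forall y, U y -> derivable f y a) ->
    (forall y, U y -> derivable ('D_a f) y b) ->
    {for x, continuous ('D_b ('D_a f))} ->
  \forall s \near (0 : R)^', `|s^-1 * s^-1 * (f (x + s *: a + s *: b) - f (x + s *: a)
      - (f (x + s *: b) - f x)) - 'D_b ('D_a f) x| <= e.
  move=> e0 fa fab cab.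
  have [d d0 dP] : exists2 d : R, 0 < d & forall h, `|h| < d ->
      U (x + h) /\ `|'D_b ('D_a f) x - 'D_b ('D_a f) (x + h)| <= e.
    apply: (@near0_ball _ _ (fun y => U y /\ `|'D_b ('D_a f) x - 'D_b ('D_a f) y| <= e)).
    near=> y; split; first by near: y; exact: open_nbhs_nbhs.
    near: y; exact: (cvgrPdist_le _ _).1 cab e e0.
  pose M := `|a| + `|b| + 1.
  have M0 : 0 < M by rewrite ltr_wpDl// addr_ge0.
  have small (s p q : R) : `|s| < d / M -> 0 <= p <= 1 -> 0 <= q <= 1 ->
     `|p *: (s *: a) + q *: (s *: b)| < d.
    move=> hM /andP[p0 p1] /andP[q0 q1].
    rewrite !scalerA ![_ * s]mulrC -!scalerA -scalerDr normrZ.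
    apply: (@le_lt_trans _ _ (`|s| * M)); last by rewrite -ltr_pdivlMr.
    rewrite ler_wpM2l//; apply: (le_trans (ler_normD _ _)).
    rewrite /M -[leLHS]addr0 lerD// lerD// normrZ ger0_norm//.
      by rewrite ler_piMl.
    by rewrite ler_piMl.
  near=> s.
  have s0 : s != 0 by near: s; exact: nbhs_dnbhs_neq.
  have sd : `|s| < d / M by near: s; apply: dnbhs0_lt; rewrite divr_gt0.
  have i1 : 0 <= (1 : R) <= 1 by rewrite ler01 lexx.
  have i0 : 0 <= (0 : R) <= 1 by rewrite ler01 lexx.
  (* The second difference is the increment of [g] along s a. The mean value theorem for [g] along
     a, then for ['D_a f] along b, turns it into s^2 times the mixed derivative at a point near
     x. *)
  pose g y := f (y + s *: b) - f y.
  have dg p : 0 <= p <= 1 -> is_derive (x + p *: (s *: a)) (s *: a) g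
     (s * 'D_a f (x + p *: (s *: a) + s *: b) - s * 'D_a f (x + p *: (s *: a))).
    move=> p01; apply: is_deriveB; last first.
      apply: derive_scale_dir; apply: fa.
      by have [] := dP _ (small s p 0 sd p01 i0); rewrite scale0r addr0.
    have [U1 _] := dP _ (small s p 1 sd p01 i1).
    rewrite scale1r addrA in U1.
    have [h1 h2] := derive_scale_dir s (fa _ U1).
    have e1 : (fun h : R => h^-1 *: (((fun y => f (y + s *: b)) \o
         shift (x + p *: (s *: a))) (h *: (s *: a)) -
         f (x + p *: (s *: a) + s *: b))) =
       (fun h : R => h^-1 *: ((f \o shift (x + p *: (s *: a) + s *: b)) (h *: (s *: a))
         - f (x + p *: (s *: a) + s *: b))).
      by apply/funext => h /=; rewrite -(addrA (h *: (s *: a))).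
    by apply: DeriveDef; rewrite ?/derivable ?/derive e1.
  have [|p /andP[p0 p1]] := @mvt_dir _ _ g x (s *: a).
    by move=> p p01; case: (dg p p01).
  have p01 : 0 <= p <= 1 by rewrite !ltW.
  have [_ ->] := dg p p01.
  rewrite -mulrBr /g.
  have dh q : 0 <= q <= 1 -> is_derive (x + p *: (s *: a) + q *: (s *: b)) (s *: b)
      ('D_a f) (s *: 'D_b ('D_a f) (x + p *: (s *: a) + q *: (s *: b))).
    move=> q01; apply: derive_scale_dir; apply: fab.
    by have [] := dP _ (small s p q sd p01 q01); rewrite addrA.
  have [|q /andP[q0 q1] ->] := @mvt_dir _ _ ('D_a f) (x + p *: (s *: a)) (s *: b).
    by move=> q q01; case: (dh q q01).
  have q01 : 0 <= q <= 1 by rewrite !ltW.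
  have [_ ->] := dh q q01 => ->.
  rewrite -[s *: 'D_b _ _]/(s * _) -mulrA (mulrA s^-1 s) mulVf// mul1r mulrA mulVf// mul1r.
  have [_] := dP _ (small s p q sd p01 q01).
  rewrite (addrA x (p *: (s *: a)) (q *: (s *: b))).
  by set X1 := 'D_b _ _; set X2 := 'D_b _ _ => H; rewrite distrC.
apply/eqP; rewrite -subr_eq0 -normr_le0; apply/ler_addgt0Pl => e e0.
have e2 : 0 < e / 2 by rewrite divr_gt0.
have [s [h1 h2]] : exists s : R,
   `|s^-1 * s^-1 * (f (x + s *: u + s *: v) - f (x + s *: u)
      - (f (x + s *: v) - f x)) - 'D_v ('D_u f) x| <= e / 2 /\
   `|s^-1 * s^-1 * (f (x + s *: v + s *: u) - f (x + s *: v)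
      - (f (x + s *: u) - f x)) - 'D_u ('D_v f) x| <= e / 2.
  apply: (@filter_ex _ (0 : R)^'); apply: filterI; exact: key.
have e1 : f (x + s *: v + s *: u) - f (x + s *: v) - (f (x + s *: u) - f x) =
   f (x + s *: u + s *: v) - f (x + s *: u) - (f (x + s *: v) - f x).
  by rewrite (addrAC x); ring.
rewrite e1 in h2; set k := s^-1 * _ * _ in h1 h2.
rewrite addr0 (splitr e).
move: ('D_v ('D_u f) x) ('D_u ('D_v f) x) h1 h2 => D1 D2 h1 h2.
have -> : D1 - D2 = (k - D2) - (k - D1) by ring.
by apply: (le_trans (ler_normB _ _)); rewrite lerD.
Unshelve. all: by end_near. Qed.

End FiniteDimensional.

(** * Closure properties of C^k maps *)

Section ContinuouslyDifferentiable.
Context {R : realType}.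
Implicit Types (V W : normedModType R).

Lemma Ck_continuous V W k (U : set V) (f : V -> W) x :
  Ck_on k U f -> U x -> {for x, continuous f}.
Proof. by case: k => [|k] [+ _]; apply. Qed.

Lemma Ck_derivable V W k (U : set V) (f : V -> W) x v :
  Ck_on k.+1 U f -> U x -> derivable f x v.
Proof. by case=> _ /(_ v)[+ _]; apply. Qed.

Lemma Ck_derive V W k (U : set V) (f : V -> W) v :
  Ck_on k.+1 U f -> Ck_on k U (fun x => 'D_v f x).
Proof. by case=> _ /(_ v)[_]. Qed.

Lemma CkS V W k (U : set V) (f : V -> W) : Ck_on k.+1 U f -> Ck_on k U f.
Proof.
elim: k f => [|k IH] f [cf df]; first by split.
split=> // v; have [d1 d2] := df v; split=> //; exact: IH.
Qed.

Lemma Ck_le V W k l (U : set V) (f : V -> W) :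
  (k <= l)%N -> Ck_on l U f -> Ck_on k U f.
Proof.
move=> /subnK <-; elim: (l - k)%N => // d IH; rewrite addSn => /CkS.
exact: IH.
Qed.

Lemma Ck_sub V W k (U U' : set V) (f : V -> W) :
  U' `<=` U -> Ck_on k U f -> Ck_on k U' f.
Proof.
move=> UU; elim: k f => [|k IH] f [cf df].
  by split=> // x /UU; exact: cf.
split=> [x /UU|v]; first exact: cf.
have [d1 d2] := df v; split=> [x /UU|]; [exact: d1|exact: IH].
Qed.

(** On an open set, pointwise agreement is agreement of germs, which is all that derivatives see.
    The closure lemmas below rely on it: their derivative formulas hold on [U] only. *)
Lemma Ck_eq V W k (U : set V) (f g : V -> W) : open U ->
  (forall x, U x -> f x = g x) -> Ck_on k U f -> Ck_on k U g.
Proof.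
move=> oU.
have nr (h h' : V -> W) x : (forall x, U x -> h x = h' x) -> U x ->
    \forall y \near x, h y = h' y.
  by move=> e Ux; near=> y; apply: e; near: y; exact: open_nbhs_nbhs.
have cont (h h' : V -> W) x : (forall x, U x -> h x = h' x) -> U x ->
    {for x, continuous h} -> {for x, continuous h'}.
  move=> e Ux ch; rewrite /prop_for/continuous_at -e//.
  by apply: cvg_trans ch; apply: near_eq_cvg; apply: nr => // y ?; rewrite e.
elim: k f g => [|k IH] f g e [cf df]; first by split=> // x Ux; apply: (cont _ _ _ e Ux); exact: cf.
split=> [x Ux|v]; first by apply: (cont _ _ _ e Ux); exact: cf.
have [d1 d2] := df v; split=> [x Ux|].
  by apply: near_eq_derivable (d1 x Ux); exact: nr.
by apply: IH d2 => x Ux; apply: near_eq_derive; exact: nr.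
Unshelve. all: by end_near. Qed.

Lemma Ck_cst V W k (U : set V) (w : W) : Ck_on k U (fun=> w).
Proof.
elim: k w => [|k IH] w.
  by split=> // x _; exact: cst_continuous.
split=> [x _|v]; first exact: cst_continuous.
split=> [x _|]; first exact: derivable_cst.
have -> : (fun x : V => 'D_v (fun=> w) x) = (fun=> 0).
  by apply/funext => x; exact: derive_cst.
exact: IH.
Qed.

Lemma CkD V W k (U : set V) (f g : V -> W) : open U ->
  Ck_on k U f -> Ck_on k U g -> Ck_on k U (fun x => f x + g x).
Proof.
move=> oU; elim: k f g => [|k IH] f g [cf df] [cg dg].
  by split=> // x Ux; apply: continuousD; [exact: cf|exact: cg].
split=> [x Ux|v]; first by apply: continuousD; [exact: cf|exact: cg].
have [d1 d2] := df v; have [e1 e2] := dg v; split=> [x Ux|].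
  by apply: derivableD; [exact: d1|exact: e1].
apply: Ck_eq (IH _ _ d2 e2) => // x Ux; apply/esym.
by apply: deriveD; [exact: d1|exact: e1].
Qed.

Lemma CkM V k (U : set V) (f g : V -> R) : open U ->
  Ck_on k U f -> Ck_on k U g -> Ck_on k U (fun x => f x * g x).
Proof.
move=> oU; elim: k f g => [|k IH] f g.
  move=> [cf df] [cg dg].
  by split=> // x Ux; apply: continuousM; [exact: cf|exact: cg].
move=> hf hg; have [cf df] := hf; have [cg dg] := hg.
split=> [x Ux|v]; first by apply: continuousM; [exact: cf|exact: cg].
have [d1 d2] := df v; have [e1 e2] := dg v; split=> [x Ux|].
  by apply: derivableM; [exact: d1|exact: e1].
apply: (@Ck_eq _ _ _ _ (fun x => f x * 'D_v g x + g x * 'D_v f x)) => //.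
  by move=> x Ux; apply/esym; apply: deriveM; [exact: d1|exact: e1].
by apply: CkD => //; apply: IH => //; exact: CkS.
Qed.

Lemma CkN V k (U : set V) (f : V -> R) : open U ->
  Ck_on k U f -> Ck_on k U (fun x => - f x).
Proof.
move=> oU hf; apply: (@Ck_eq _ _ _ _ (fun x => -1 * f x)) => //.
  by move=> x _; rewrite mulN1r.
by apply: CkM => //; exact: Ck_cst.
Qed.

Lemma Ck_sum V k (U : set V) (I : Type) (r : seq I) (P : pred I)
    (f : I -> V -> R) : open U ->
  (forall i, Ck_on k U (f i)) -> Ck_on k U (fun x => \sum_(i <- r | P i) f i x).
Proof.
move=> oU hf; elim: r => [|i r IH].
  apply: Ck_eq (Ck_cst k U (0 : R)) => // x _; by rewrite big_nil.
have [Pi|nPi] := boolP (P i).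
  apply: Ck_eq (CkD oU (hf i) IH) => // x _; by rewrite big_cons Pi.
by apply: Ck_eq IH => // x _; rewrite big_cons (negPf nPi).
Qed.

Lemma Ck_prod V k (U : set V) (I : Type) (r : seq I) (P : pred I)
    (f : I -> V -> R) : open U ->
  (forall i, Ck_on k U (f i)) -> Ck_on k U (fun x => \prod_(i <- r | P i) f i x).
Proof.
move=> oU hf; elim: r => [|i r IH].
  apply: Ck_eq (Ck_cst k U (1 : R)) => // x _; by rewrite big_nil.
have [Pi|nPi] := boolP (P i).
  apply: Ck_eq (CkM oU (hf i) IH) => // x _; by rewrite big_cons Pi.
by apply: Ck_eq IH => // x _; rewrite big_cons (negPf nPi).
Qed.

Lemma CkV V k (U : set V) (f : V -> R) : open U -> (forall x, U x -> f x != 0) ->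
  Ck_on k U f -> Ck_on k U (fun x => (f x)^-1).
Proof.
move=> oU f0; elim: k => [|k IH] hf.
  by split=> // x Ux; apply: continuousV; [exact: f0|exact: Ck_continuous hf _].
split=> [x Ux|v].
  by apply: continuousV; [exact: f0|exact: Ck_continuous hf _].
split=> [x Ux|].
  by apply: derivableV; [exact: f0|exact: Ck_derivable hf _].
apply: (@Ck_eq _ _ _ _ (fun x => - ((f x)^-1 * (f x)^-1 * 'D_v f x))) => //.
  move=> x Ux; rewrite deriveV ?f0//; last exact: Ck_derivable hf _.
  by rewrite -exprVn expr2 -scaleNr.
apply: CkN => //; apply: CkM => //; last exact: Ck_derive.
by apply: CkM => //; apply: IH; exact: CkS.
Qed.

Lemma Ck_mxP V k m n (U : set V) (f : V -> 'M[R]_(m, n)) : open U ->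
  Ck_on k U f <-> forall a b, Ck_on k U (fun x => f x a b).
Proof.
move=> oU; elim: k f => [|k IH] f; split.
- move=> [cf _] a b; split=> // x Ux.
  apply: (@continuous_comp _ _ _ f (fun M : 'M[R]_(m, n) => M a b)).
    exact: cf.
  exact: coord_continuous.
- move=> h; split=> // x Ux; apply/cvgrPdist_le => e e0.
  near=> y; rewrite [leLHS]/Num.Def.normr/= mx_normrE.
  apply: bigmax_le => [|[a b] _/=]; first exact: ltW.
  rewrite !mxE; move: a b; near: y.
  apply: filter_forall => a; apply: filter_forall => b.
  apply: (cvgrPdist_le _ _).1 e e0.
  exact: (h a b).1.
- move=> [cf df] a b; split=> [x Ux|v].
    apply: (@continuous_comp _ _ _ f (fun M : 'M[R]_(m, n) => M a b)).
      exact: cf.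
    exact: coord_continuous.
  have [d1 d2] := df v; split=> [x Ux|].
    exact: (derivable_mxP _ _ _).1 (d1 x Ux) a b.
  have := (IH _).1 d2 a b; apply: Ck_eq => // x Ux.
  by rewrite derive_mx ?mxE//; exact: d1.
- move=> h; split=> [x Ux|v].
    apply/cvgrPdist_le => e e0.
    near=> y; rewrite [leLHS]/Num.Def.normr/= mx_normrE.
    apply: bigmax_le => [|[a b] _/=]; first exact: ltW.
    rewrite !mxE; move: a b; near: y.
    apply: filter_forall => a; apply: filter_forall => b.
    apply: (cvgrPdist_le _ _).1 e e0.
    exact: (h a b).1.
  have d1 x : U x -> derivable f x v.
    move=> Ux; apply/derivable_mxP => a b; exact: Ck_derivable (h a b) Ux.
  split=> //; apply/IH => a b; have := Ck_derive v (h a b).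
  apply: Ck_eq => // x Ux.
  by rewrite derive_mx ?mxE//; exact: d1.
Unshelve. all: by end_near. Qed.

Lemma derive_mxE V m n (f : V -> 'M[R]_(m, n)) x v a b : derivable f x v ->
  'D_v f x a b = 'D_v (fun y => f y a b) x.
Proof. by move=> /derive_mx ->; rewrite mxE. Qed.

Lemma differentiable_mx V m n (f : V -> 'M[R]_(m, n)) x :
  (forall a b, differentiable (fun y => f y a b) x) -> differentiable f x.
Proof.
move=> df.
have -> : f = \sum_a (\sum_b (fun y => f y a b *: delta_mx a b)).
  apply/funext => y; rewrite [LHS]matrix_sum_delta fct_sumE.
  by apply: eq_bigr => a _; rewrite fct_sumE.
apply: differentiable_sum => a; apply: differentiable_sum => b.
by apply: differentiableZl.
Qed.

Lemma differentiable_C1_mx p m n (f : 'rV[R]_p -> 'M[R]_(m, n)) (U : set 'rV[R]_p) x :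
  open U -> U x -> Ck_on 1 U f -> differentiable f x.
Proof.
move=> oU Ux /(Ck_mxP _ _ oU) h; apply: differentiable_mx => a b.
exact: differentiable_C1 oU Ux (h a b).
Qed.

Lemma derive_comm p m n (f : 'rV[R]_p -> 'M[R]_(m, n)) (U : set 'rV[R]_p) x u v :
  open U -> U x -> Ck_on 2 U f -> 'D_v ('D_u f) x = 'D_u ('D_v f) x.
Proof.
move=> oU Ux hf; apply/matrixP => a b.
have := (Ck_mxP 2 f oU).1 hf a b => hab.
have d1 y w : U y -> derivable f y w by exact: Ck_derivable hf.
have e (s t : 'rV[R]_p) : 'D_s ('D_t f) x a b = 'D_s ('D_t (fun y => f y a b)) x.
  rewrite derive_mxE; last exact: Ck_derivable (Ck_derive t hf) Ux.
  apply: near_eq_derive; near=> y; apply: derive_mxE; apply: d1.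
  by near: y; exact: open_nbhs_nbhs.
apply: (etrans (e v u)); apply: (etrans _ (esym (e u v))).
apply: (@derive_comm_C2 _ _ (fun y => f y a b) U x u v oU Ux).
- by move=> y; exact: Ck_derivable hab.
- by move=> y; exact: Ck_derivable hab.
- by move=> y; exact: Ck_derivable (Ck_derive u hab).
- by move=> y; exact: Ck_derivable (Ck_derive v hab).
- exact: Ck_continuous (Ck_derive v (Ck_derive u hab)) Ux.
- exact: Ck_continuous (Ck_derive u (Ck_derive v hab)) Ux.
Unshelve. all: by end_near. Qed.

(** The derivative of the composite is the sum over a of (D_v f)_a times the composite of the a-th
    partial derivative of [g] with [f]. The induction therefore runs over all [g] with [f] fixed,
    and each step uses the differentiability of the C^1 map [g]. *)
Lemma Ck_comp V p k (U : set V) (f : V -> 'rV[R]_p) (U' : set 'rV[R]_p)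
    (g : 'rV[R]_p -> R) : open U -> open U' -> (forall x, U x -> U' (f x)) ->
  Ck_on k U f -> Ck_on k U' g -> Ck_on k U (fun x => g (f x)).
Proof.
move=> oU oU' UU'; elim: k g => [|k IH] g hf hg.
  split=> // x Ux; apply: continuous_comp; first exact: Ck_continuous hf Ux.
  exact: Ck_continuous hg (UU' _ Ux).
have dg x : U x -> differentiable g (f x).
  move=> Ux; apply: (@differentiable_C1 _ _ _ U') => //; first exact: UU'.
  exact: Ck_le hg.
split=> [x Ux|v].
  apply: continuous_comp; first exact: Ck_continuous hf Ux.
  exact: Ck_continuous hg (UU' _ Ux).
have dc x : U x -> is_derive x v (g \o f) ('D_('D_v f x) g (f x)).
  move=> Ux; apply: is_derive_comp_diff; last exact: dg.
  by apply: derivableP; exact: Ck_derivable hf Ux.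
split=> [x Ux|]; first by case: (dc x Ux).
apply: (@Ck_eq _ _ _ _ (fun x => \sum_a 'D_v f x ord0 a * 'D_(delta_mx ord0 a) g (f x))) => //.
  move=> x Ux; have [_ ->] := dc x Ux.
  apply/esym; apply: (@derive_sum_C1 _ _ _ U') => //; first exact: UU'.
  exact: Ck_le hg.
apply: Ck_sum => // a; apply: CkM => //.
  exact: ((Ck_mxP _ _ oU).1 (Ck_derive v hf)).
exact: (IH (fun y => 'D_(delta_mx ord0 a) g y) (CkS hf) (Ck_derive _ hg)).
Qed.

Lemma Ck_comp_mx V p m n k (U : set V) (f : V -> 'rV[R]_p) (U' : set 'rV[R]_p)
    (g : 'rV[R]_p -> 'M[R]_(m, n)) : open U -> open U' ->
  (forall x, U x -> U' (f x)) ->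
  Ck_on k U f -> Ck_on k U' g -> Ck_on k U (fun x => g (f x)).
Proof.
move=> oU oU' UU' hf /(Ck_mxP _ _ oU') hg; apply/Ck_mxP => // a b.
exact: (Ck_comp oU oU' UU' hf (hg a b)).
Qed.

Lemma Ck_mulmx V m n p k (U : set V) (f : V -> 'M[R]_(m, n)) (g : V -> 'M[R]_(n, p)) :
  open U -> Ck_on k U f -> Ck_on k U g -> Ck_on k U (fun x => f x *m g x).
Proof.
move=> oU /(Ck_mxP _ _ oU) hf /(Ck_mxP _ _ oU) hg; apply/Ck_mxP => // a b.
apply: (@Ck_eq _ _ _ _ (fun x => \sum_c f x a c * g x c b)) => //.
  by move=> x _; rewrite mxE.
by apply: Ck_sum => // c; exact: CkM.
Qed.

Lemma Ck_tr V m n k (U : set V) (f : V -> 'M[R]_(m, n)) :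
  open U -> Ck_on k U f -> Ck_on k U (fun x => (f x)^T).
Proof.
move=> oU /(Ck_mxP _ _ oU) hf; apply/Ck_mxP => // a b.
by apply: Ck_eq (hf b a) => // x _; rewrite mxE.
Qed.

Lemma Ck_det V n k (U : set V) (f : V -> 'M[R]_n) :
  open U -> Ck_on k U f -> Ck_on k U (fun x => \det (f x)).
Proof.
move=> oU /(Ck_mxP _ _ oU) hf; rewrite /determinant.
apply: Ck_sum => // s; apply: CkM => //; first exact: Ck_cst.
by apply: Ck_prod => // a; exact: hf.
Qed.

Lemma Ck_invmx V n k (U : set V) (f : V -> 'M[R]_n) :
  open U -> (forall x, U x -> f x \in unitmx) ->
  Ck_on k U f -> Ck_on k U (fun x => invmx (f x)).
Proof.
move=> oU fu hf; apply/Ck_mxP => // a b.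
apply: (@Ck_eq _ _ _ _ (fun x => (\det (f x))^-1 * cofactor (f x) b a)) => //.
  by move=> x Ux; rewrite /invmx fu// !mxE.
apply: CkM => //.
  apply: CkV => //; last exact: Ck_det.
  by move=> x /fu; rewrite unitmxE unitfE.
rewrite /cofactor; apply: CkM => //; first exact: Ck_cst.
apply: Ck_det => //; apply/Ck_mxP => // c d.
apply: (Ck_eq _ _ ((Ck_mxP _ _ oU).1 hf (lift b c) (lift a d))) => //.
by move=> x _; rewrite !mxE.
Qed.

Lemma CkZ V m n k (U : set V) (c : V -> R) (f : V -> 'M[R]_(m, n)) :
  open U -> Ck_on k U c -> Ck_on k U f -> Ck_on k U (fun x => c x *: f x).
Proof.
move=> oU hc /(Ck_mxP _ _ oU) hf; apply/Ck_mxP => // a b.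
apply: (@Ck_eq _ _ _ _ (fun x => c x * f x a b)) => //; last exact: CkM.
by move=> x _; rewrite mxE.
Qed.

Lemma CkB V m n k (U : set V) (f g : V -> 'M[R]_(m, n)) : open U ->
  Ck_on k U f -> Ck_on k U g -> Ck_on k U (fun x => f x - g x).
Proof.
move=> oU hf hg; apply: (@Ck_eq _ _ _ _ (fun x => f x + -1 *: g x)) => //.
  by move=> x _; rewrite scaleN1r.
by apply: CkD => //; apply: CkZ => //; exact: Ck_cst.
Qed.

Lemma Ck_sum_mx V m n k (U : set V) (I : Type) (r : seq I) (P : pred I)
    (f : I -> V -> 'M[R]_(m, n)) : open U ->
  (forall i, Ck_on k U (f i)) -> Ck_on k U (fun x => \sum_(i <- r | P i) f i x).
Proof.
move=> oU hf; apply/Ck_mxP => // a b.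
apply: (@Ck_eq _ _ _ _ (fun x => \sum_(i <- r | P i) f i x a b)) => //.
  by move=> x _; rewrite summxE.
by apply: Ck_sum => // i; exact: (Ck_mxP _ _ oU).1.
Qed.

End ContinuouslyDifferentiable.

(** * Families of linear and bilinear maps *)

Section LinearFamilies.
Context {R : realType}.

(** A predicate rather than a bundled map: families such as the tangent maps of a chart expression
    are linear only at the points of an open set. *)
Definition lin {U V : lmodType R} (f : U -> V) : Prop :=
  forall c u v, f (c *: u + v) = c *: f u + f v.

Definition bilin {U V W : lmodType R} (f : U -> V -> W) : Prop :=
  (forall v, lin (f^~ v)) /\ (forall u, lin (f u)).

Section Lin.
Context {U V : lmodType R} (f : U -> V).
Hypothesis lf : lin f.

Lemma linD u v : f (u + v) = f u + f v.
Proof. by rewrite -[u in LHS]scale1r lf scale1r. Qed.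

Lemma lin0 : f 0 = 0.
Proof. by apply: (addrI (f 0)); rewrite -linD !addr0. Qed.

Lemma linZ c u : f (c *: u) = c *: f u.
Proof. by rewrite -[c *: u]addr0 lf lin0 addr0. Qed.

Lemma linN u : f (- u) = - f u.
Proof. by rewrite -scaleN1r linZ scaleN1r. Qed.

Lemma linB u v : f (u - v) = f u - f v.
Proof. by rewrite linD linN. Qed.

Lemma lin_sum (I : Type) (r : seq I) (P : pred I) (h : I -> U) :
  f (\sum_(i <- r | P i) h i) = \sum_(i <- r | P i) f (h i).
Proof.
elim: r => [|i r IH]; first by rewrite !big_nil lin0.
by rewrite !big_cons; case: (P i) => //; rewrite linD IH.
Qed.

End Lin.

Lemma lin_row p (W : lmodType R) (f : 'rV[R]_p -> W) : lin f ->
  forall z, f z = \sum_a z ord0 a *: f (delta_mx ord0 a).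
Proof.
move=> lf z; rewrite [in LHS](row_sum z) lin_sum//.
by apply: eq_bigr => a _; rewrite linZ.
Qed.

Section Lin1.
Context {E : normedModType R} {p : nat}.

(** Leibniz rule for s |-> L_s(u_s). Expanding u_s in the standard basis reduces it to finitely many
    products of scalar functions, so derivability of L on each fixed vector suffices and no topology
    on linear maps is involved. *)
Lemma is_derive_lin (L : E -> 'rV[R]_p -> R) (u : E -> 'rV[R]_p) t v u' :
  (\forall s \near t, lin (L s : 'rV[R]_p -> R^o)) ->
  (forall z, derivable (L^~ z) t v) -> is_derive t v u u' ->
  is_derive t v (fun s => L s (u s)) ('D_v (L^~ (u t)) t + L t u').
Proof.
move=> lL dL [du <-].
have lt : lin (L t : 'rV[R]_p -> R^o) by exact: nbhs_singleton lL.
pose f := \sum_a (fun s => u s ord0 a * L s (delta_mx ord0 a)).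
have ef : \forall s \near t, f s = L s (u s).
  by apply: filterS lL => s ls; rewrite /f fct_sumE [RHS](lin_row ls).
apply: near_eq_is_derive ef _.
have dua a : derivable (fun s => u s ord0 a) t v by exact: (derivable_mxP _ _ _).1.
have [df e] : is_derive t v f (\sum_a
    (u t ord0 a *: 'D_v (L^~ (delta_mx ord0 a)) t
     + L t (delta_mx ord0 a) *: 'D_v (fun s => u s ord0 a) t)).
  apply: is_derive_sum => a; apply: is_deriveM; exact: derivableP.
apply: DeriveDef => //; rewrite e big_split/=; congr (_ + _).
  pose k := \sum_a (fun s => u t ord0 a *: L s (delta_mx ord0 a)).
  have ek : \forall s \near t, k s = L s (u t).
    by apply: filterS lL => s ls; rewrite /k fct_sumE [RHS](lin_row ls).
  rewrite -(near_eq_derive _ ek) derive_sum; last first.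
    by move=> a; apply: derivableZ.
  by apply: eq_bigr => a _; rewrite deriveZ.
rewrite [RHS](lin_row lt); apply: eq_bigr => a _.
by rewrite derive_mxE// [LHS]mulrC.
Qed.

End Lin1.

Lemma is_derive_lin_mx {E : normedModType R} p m n
    (L : E -> 'rV[R]_p -> 'M[R]_(m, n)) (u : E -> 'rV[R]_p) t v u' :
  (\forall s \near t, lin (L s)) ->
  (forall z, derivable (L^~ z) t v) -> is_derive t v u u' ->
  is_derive t v (fun s => L s (u s)) ('D_v (L^~ (u t)) t + L t u').
Proof.
move=> lL dL du.
have h a b : is_derive t v (fun s => L s (u s) a b)
    ('D_v (fun s => L s (u t) a b) t + L t u' a b).
  apply: (@is_derive_lin _ _ (fun s z => L s z a b)) du => [|z].
    by apply: filterS lL => s ls c x y; rewrite ls !mxE.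
  exact: (derivable_mxP _ _ _).1.
have d : derivable (fun s => L s (u s)) t v.
  by apply/derivable_mxP => a b; case: (h a b).
apply: DeriveDef => //; apply/matrixP => a b.
apply: (etrans (derive_mxE _ _ d)); have [_ ->] := h a b.
by rewrite [RHS]mxE; congr (_ + _); exact/esym/derive_mxE/dL.
Qed.

Lemma is_derive_bilin {E : normedModType R} p q (B : E -> 'rV[R]_p -> 'rV[R]_q -> R)
    (u : E -> 'rV[R]_p) (w : E -> 'rV[R]_q) t v u' w' :
  (\forall s \near t, bilin (B s : 'rV[R]_p -> 'rV[R]_q -> R^o)) ->
  (forall y z, derivable (fun s => B s y z) t v) ->
  is_derive t v u u' -> is_derive t v w w' ->
  is_derive t v (fun s => B s (u s) (w s))
    ('D_v (fun s => B s (u t) (w t)) t + B t u' (w t) + B t (u t) w').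
Proof.
move=> lB dB du dw.
have h z : is_derive t v (fun s => B s z (w s))
    ('D_v (fun s => B s z (w t)) t + B t z w').
  by apply: (@is_derive_lin _ _ (fun s => B s z) w) => //; apply: filterS lB => s [].
have := @is_derive_lin _ _ (fun s z => B s z (w s)) u t v u'.
have [_ ->] := h (u t); rewrite addrAC; apply => //.
by apply: filterS lB => s [+ _]; apply.
Qed.

Lemma is_derive_bilin_mx {E : normedModType R} p q m n
    (B : E -> 'rV[R]_p -> 'rV[R]_q -> 'M[R]_(m, n))
    (u : E -> 'rV[R]_p) (w : E -> 'rV[R]_q) t v u' w' :
  (\forall s \near t, bilin (B s)) ->
  (forall y z, derivable (fun s => B s y z) t v) ->
  is_derive t v u u' -> is_derive t v w w' ->
  is_derive t v (fun s => B s (u s) (w s))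
    ('D_v (fun s => B s (u t) (w t)) t + B t u' (w t) + B t (u t) w').
Proof.
move=> lB dB du dw.
have h z : is_derive t v (fun s => B s z (w s))
    ('D_v (fun s => B s z (w t)) t + B t z w').
  by apply: (@is_derive_lin_mx _ _ _ _ (fun s => B s z) w) => //; apply: filterS lB => s [].
have := @is_derive_lin_mx _ _ _ _ (fun s z => B s z (w s)) u t v u'.
have [_ ->] := h (u t); rewrite addrAC; apply => //.
by apply: filterS lB => s [+ _]; apply.
Qed.

Lemma is_derive_comp_C1 {E : normedModType R} p m n (U : set 'rV[R]_p)
    (f : 'rV[R]_p -> 'M[R]_(m, n)) (c : E -> 'rV[R]_p) t v c' :
  open U -> U (c t) -> Ck_on 1 U f -> is_derive t v c c' ->
  is_derive t v (fun s => f (c s)) ('D_c' f (c t)).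
Proof.
move=> oU Uc hf dc; apply: is_derive_comp_diff dc _.
exact: differentiable_C1_mx oU Uc hf.
Qed.

Lemma is_derive_comp_C1R {E : normedModType R} p (U : set 'rV[R]_p)
    (f : 'rV[R]_p -> R) (c : E -> 'rV[R]_p) t v c' :
  open U -> U (c t) -> Ck_on 1 U f -> is_derive t v c c' ->
  is_derive t v (fun s => f (c s)) ('D_c' f (c t)).
Proof.
move=> oU Uc hf dc; apply: is_derive_comp_diff dc _.
exact: differentiable_C1 oU Uc hf.
Qed.

Lemma Ck_lin {E : normedModType R} p m n k (U : set E)
    (L : E -> 'rV[R]_p -> 'M[R]_(m, n)) (u : E -> 'rV[R]_p) : open U ->
  (forall x, U x -> lin (L x)) -> (forall z, Ck_on k U (L^~ z)) -> Ck_on k U u ->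
  Ck_on k U (fun x => L x (u x)).
Proof.
move=> oU lL hL hu.
apply: (@Ck_eq _ _ _ _ _ (fun x => \sum_a u x ord0 a *: L x (delta_mx ord0 a))) => //.
  by move=> x Ux; rewrite [RHS](lin_row (lL x Ux)).
by apply: Ck_sum_mx => // a; apply: CkZ => //; exact: (Ck_mxP _ _ oU).1.
Qed.

Lemma Ck_bilin {E : normedModType R} p q m n k (U : set E)
    (B : E -> 'rV[R]_p -> 'rV[R]_q -> 'M[R]_(m, n))
    (u : E -> 'rV[R]_p) (w : E -> 'rV[R]_q) : open U ->
  (forall x, U x -> bilin (B x)) -> (forall y z, Ck_on k U (fun x => B x y z)) ->
  Ck_on k U u -> Ck_on k U w -> Ck_on k U (fun x => B x (u x) (w x)).
Proof.
move=> oU lB hB hu hw.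
apply: (@Ck_lin _ _ _ _ _ _ (fun x z => B x z (w x))) => // [x /lB[]//|z].
by apply: (@Ck_lin _ _ _ _ _ _ (fun x y => B x z y)) => // x /lB[].
Qed.

Lemma near_open {E F : normedModType R} (U : set F) (c : E -> F) t :
  open U -> U (c t) -> {for t, continuous c} -> \forall s \near t, U (c s).
Proof. by move=> oU Uc cc; apply: cc; exact: open_nbhs_nbhs. Qed.

Lemma near_open_derive p (U : set 'rV[R]_p) (c : R -> 'rV[R]_p) t c' :
  open U -> U (c t) -> is_derive t 1 c c' -> \forall s \near t, U (c s).
Proof.
move=> oU Uc [dc _]; apply: near_open => //.
exact/differentiable_continuous/derivable1_diffP.
Qed.

Lemma derive_lin_dir p m n (f : 'rV[R]_p -> 'M[R]_(m, n)) (U : set 'rV[R]_p) x :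
  open U -> U x -> Ck_on 1 U f -> lin (fun v => 'D_v f x).
Proof.
move=> oU Ux hf c u v.
rewrite !(deriveE _ (differentiable_C1_mx oU Ux hf)).
by rewrite linearD linearZ.
Qed.

End LinearFamilies.

(** * Metrics and connections on open sets *)

Section InnerProduct.
Context {R : realType}.

(** The form is extracted from an opaque witness, so that inner products are not unfolded to matrix
    products during unification. *)
Fact inner_spec m : {f : 'M[R]_m -> 'rV[R]_m -> 'rV[R]_m -> R |
  forall G u v, f G u v = (u *m G *m v^T) ord0 ord0}.
Proof. by exists (fun G u v => (u *m G *m v^T) ord0 ord0). Qed.

Definition inner {m} := sval (inner_spec m).

Lemma inner_mx m (G : 'M[R]_m) u v : inner G u v = (u *m G *m v^T) ord0 ord0.
Proof. exact: (svalP (inner_spec m)). Qed.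

Lemma innerDl m (G : 'M[R]_m) u v w : inner G (u + v) w = inner G u w + inner G v w.
Proof. by rewrite !inner_mx !mulmxDl mxE. Qed.

Lemma innerDr m (G : 'M[R]_m) u v w : inner G u (v + w) = inner G u v + inner G u w.
Proof. by rewrite !inner_mx linearD mulmxDr mxE. Qed.

Lemma innerZl m (G : 'M[R]_m) c u w : inner G (c *: u) w = c * inner G u w.
Proof. by rewrite !inner_mx -!scalemxAl mxE. Qed.

Lemma innerZr m (G : 'M[R]_m) c u w : inner G u (c *: w) = c * inner G u w.
Proof. by rewrite !inner_mx linearZ -scalemxAr mxE. Qed.

Lemma inner0l m (G : 'M[R]_m) w : inner G 0 w = 0.
Proof. by rewrite !inner_mx !mul0mx mxE. Qed.

Lemma inner0r m (G : 'M[R]_m) w : inner G w 0 = 0.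
Proof. by rewrite !inner_mx trmx0 mulmx0 mxE. Qed.

Lemma innerNl m (G : 'M[R]_m) u w : inner G (- u) w = - inner G u w.
Proof. by rewrite -scaleN1r innerZl mulN1r. Qed.

Lemma innerNr m (G : 'M[R]_m) u w : inner G u (- w) = - inner G u w.
Proof. by rewrite -scaleN1r innerZr mulN1r. Qed.

Definition innerE := (innerDl, innerDr, innerNl, innerNr, inner0l, inner0r).

Lemma inner_bilin m (G : 'M[R]_m) : bilin (inner G : 'rV[R]_m -> 'rV[R]_m -> R^o).
Proof.
by split=> v c u w; rewrite ?innerDl ?innerDr ?innerZl ?innerZr.
Qed.

Lemma inner_sym m (G : 'M[R]_m) u v : G^T = G -> inner G u v = inner G v u.
Proof.
move=> sG; rewrite !inner_mx -[RHS]trace_mx11 -mxtrace_tr !trmx_mul trmxK sG.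
by rewrite trace_mx11 mulmxA.
Qed.

End InnerProduct.

(* [ring] on inner products as atoms: comparing them up to conversion is slow. *)
Ltac inner_ring := repeat match goal with
  |- context [@inner ?R ?m ?G ?u ?v] => generalize (@inner R m G u v); intro end; ring.

Ltac inner_lra := repeat match goal with
  |- context [@inner ?R ?m ?G ?u ?v] => generalize (@inner R m G u v); intro end;
  intros; lra.

(** [row_abel] proves identities of abelian groups between row vectors: everything except sums,
    opposites and zero is generalized, and the rest is checked entrywise. *)
Ltac atomize t := match t with
  | @Algebra.add _ _ _ => fail 1 | @Algebra.opp _ _ => fail 1 | @Algebra.zero _ => fail 1
  | _ => tryif is_var t then fail else (generalize t; intro) end.

Ltac row_abel := repeat match goal with
  | |- context [@Algebra.add _ ?a ?b] => first [atomize a | atomize b]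
  | |- context [@Algebra.opp _ ?a] => atomize a
  | |- @eq _ ?a _ => atomize a
  | |- @eq _ _ ?a => atomize a
  end; apply/rowP => ?; rewrite !mxE; ring.

(* Sealed, because comparing two derivatives up to conversion unfolds the limits. *)
Fact tmap_spec (R : realType) m n :
  {f : ('rV[R]_m -> 'rV[R]_n) -> 'rV[R]_m -> 'rV[R]_m -> 'rV[R]_n |
    forall F x u, f F x u = 'D_u F x}.
Proof. by exists (fun F x u => 'D_u F x). Qed.

Definition tmap {R : realType} {m n} := sval (tmap_spec R m n).

Lemma tmapE {R : realType} {m n} (F : 'rV[R]_m -> 'rV[R]_n) x u :
  tmap F x u = 'D_u F x.
Proof. exact: (svalP (tmap_spec R m n)). Qed.

Lemma tmap_lin_C1 {R : realType} {m n} (F : 'rV[R]_m -> 'rV[R]_n) (U : set 'rV[R]_m) x :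
  open U -> U x -> Ck_on 1 U F -> lin (tmap F x).
Proof.
move=> oU Ux hF c u v; rewrite !tmapE; exact: derive_lin_dir oU Ux hF c u v.
Qed.

Section ChartGeometry.
Context {R : realType}.

(* v is meant to be the derivative of c at s in the direction d, and DV the
   covariant derivative of the field V along c. *)
Definition covder {E : normedModType R} {m}
    (Gam : 'rV[R]_m -> 'rV[R]_m -> 'rV[R]_m -> 'rV[R]_m)
    (c : E -> 'rV[R]_m) (v : 'rV[R]_m) (V : E -> 'rV[R]_m) (s d : E)
    (DV : 'rV[R]_m) : Prop :=
  is_derive s d V (DV - Gam (c s) v (V s)).

(** The Riemann tensor R(u,v)w computed with constant extensions; these commute, which removes the
    bracket term. *)
Definition curv {m} (Gam : 'rV[R]_m -> 'rV[R]_m -> 'rV[R]_m -> 'rV[R]_m)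
    (x u v w : 'rV[R]_m) : 'rV[R]_m :=
  tmap (fun y : 'rV[R]_m => Gam y v w) x u - tmap (fun y : 'rV[R]_m => Gam y u w) x v
  + Gam x u (Gam x v w) - Gam x v (Gam x u w).

(** The formula for the Christoffel symbols is forgotten here. Symmetry and compatibility with the
    metric characterize the Levi-Civita connection, and the geometric arguments rest on these two
    properties. *)
Record local_metric m (O : set 'rV[R]_m) (G : 'rV[R]_m -> 'M[R]_m)
    (Gam : 'rV[R]_m -> 'rV[R]_m -> 'rV[R]_m -> 'rV[R]_m) : Prop := LocalMetric {
  lm_open : open O ;
  lm_sym : forall x, O x -> (G x)^T = G x ;
  lm_pos : forall x u, O x -> u <> 0 -> 0 < inner (G x) u u ;
  lm_smooth : forall k, Ck_on k O G ;
  lm_bilin : forall x, bilin (Gam x) ;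
  lm_torsion : forall x u v, O x -> Gam x u v = Gam x v u ;
  lm_conn_smooth : forall k u v, Ck_on k O (fun x => Gam x u v) ;
  lm_compat : forall x u v w, O x -> 'D_u (fun y : 'rV[R]_m => inner (G y) v w) x =
    inner (G x) (Gam x u v) w + inner (G x) v (Gam x u w)
}.

Section LocalMetric.
Context {m : nat} {O : set 'rV[R]_m} {G : 'rV[R]_m -> 'M[R]_m}.
Context {Gam : 'rV[R]_m -> 'rV[R]_m -> 'rV[R]_m -> 'rV[R]_m}.
Hypothesis LM : local_metric O G Gam.

Lemma inner_smooth k u v : Ck_on k O (fun x => inner (G x) u v).
Proof.
have oO := lm_open LM.
have h : Ck_on k O (fun x => u *m G x *m v^T).
  by do 2![apply: Ck_mulmx => //; try exact: Ck_cst]; exact: (lm_smooth LM).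
by apply: Ck_eq ((Ck_mxP _ _ oO).1 h ord0 ord0) => // x _; rewrite inner_mx.
Qed.

Lemma inner_eq0 x u : O x -> inner (G x) u u = 0 -> u = 0.
Proof.
move=> Ox u0; apply: contrapT => nu.
by have := lm_pos LM Ox nu; rewrite u0 ltxx.
Qed.

(** Differentiating the Gram matrix produces, by [lm_compat], exactly the two connection terms that
    [covder] subtracts from the plain derivatives of the fields. *)
Lemma inner_compat {E : normedModType R} (c V W : E -> 'rV[R]_m) s d v DV DW :
  O (c s) -> is_derive s d c v ->
  covder Gam c v V s d DV -> covder Gam c v W s d DW ->
  is_derive s d (fun t => inner (G (c t)) (V t) (W t))
    (inner (G (c s)) DV (W s) + inner (G (c s)) (V s) DW).
Proof.
move=> Oc dc dV dW; have oO := lm_open LM.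
have h y z : is_derive s d (fun t => inner (G (c t)) y z)
    ('D_v (fun x => inner (G x) y z) (c s)).
  exact: (is_derive_comp_C1R oO Oc (inner_smooth 1 y z) dc).
have [d1 e] := @is_derive_bilin R E m m (fun t => inner (G (c t))) V W s d _ _
  (nearW _ (fun t => inner_bilin (G (c t)))) (fun y z => @ex_derive _ _ _ _ _ _ _ (h y z)) dV dW.
apply: DeriveDef => //; rewrite e.
have [_ ->] := h (V s) (W s); rewrite (lm_compat LM)//.
rewrite !innerE; inner_ring.
Qed.

Lemma conn_derive {E : normedModType R} (c : E -> 'rV[R]_m) s d v y z :
  O (c s) -> is_derive s d c v ->
  is_derive s d (fun t => Gam (c t) y z)
    (tmap (fun x : 'rV[R]_m => Gam x y z) (c s) v).
Proof.
rewrite tmapE => Oc dc; exact: (is_derive_comp_C1 (lm_open LM) Oc (lm_conn_smooth LM 1 y z) dc).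
Qed.

Lemma covder_cst {E : normedModType R} (c : E -> 'rV[R]_m) s d v z :
  covder Gam c v (fun=> z) s d (Gam (c s) v z).
Proof. by rewrite /covder subrr; exact: is_derive_cst. Qed.

Lemma near_self x : O x -> \forall y \near x, O y.
Proof. by move=> Ox; apply: open_nbhs_nbhs; split=> //; exact: lm_open LM. Qed.

(** For constant z and w, the function <z, w> has commuting second derivatives. Writing both orders
    with compatibility, the terms pairing two connection forms are symmetric in the two directions
    and cancel; what remains are the two curvature terms. *)
Lemma curv_anti x u v z w : O x ->
  inner (G x) (curv Gam x u v z) w = - inner (G x) z (curv Gam x u v w).
Proof.
move=> Ox; have oO := lm_open LM.
have sG := lm_sym LM Ox.
have dd a b : 'D_a ('D_b (fun y : 'rV[R]_m => inner (G y) z w)) x =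
    inner (G x) (tmap (fun y : 'rV[R]_m => Gam y b z) x a + Gam x a (Gam x b z)) w
    + inner (G x) (Gam x b z) (Gam x a w)
    + (inner (G x) (Gam x a z) (Gam x b w) +
       inner (G x) z (tmap (fun y : 'rV[R]_m => Gam y b w) x a + Gam x a (Gam x b w))).
  have dG y : covder Gam id a (fun t => Gam t b y) x a
      (tmap (fun t : 'rV[R]_m => Gam t b y) x a + Gam x a (Gam x b y)).
    rewrite /covder addrK; apply: conn_derive => //; exact: is_derive_id.
  have h1 := inner_compat Ox (is_derive_id _ _) (dG z) (covder_cst id x a a w).
  have h2 := inner_compat Ox (is_derive_id _ _) (covder_cst id x a a z) (dG w).
  have [_ <-] := is_deriveD h1 h2.
  apply: near_eq_derive; apply: filterS (near_self Ox) => y Oy.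
  by rewrite (lm_compat LM).
have := @derive_comm_C2 R _ (fun y : 'rV[R]_m => inner (G y) z w) O x u v oO Ox.
have sm := inner_smooth 2 z w.
move=> /(_ _ _ _ _ _ _)/wrap[||||||e].
- by move=> y; exact: Ck_derivable sm.
- by move=> y; exact: Ck_derivable sm.
- by move=> y; exact: Ck_derivable (Ck_derive u sm).
- by move=> y; exact: Ck_derivable (Ck_derive v sm).
- exact: Ck_continuous (Ck_derive v (Ck_derive u sm)) Ox.
- exact: Ck_continuous (Ck_derive u (Ck_derive v sm)) Ox.
move: e; rewrite !dd /curv !innerE => /eqP; rewrite -subr_eq0 => /eqP e.
apply/eqP; rewrite -subr_eq0 opprK -oppr_eq0 -e; apply/eqP.
inner_ring.
Qed.

Lemma curv0 x u v : curv Gam x u v 0 = 0.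
Proof.
have h y w : Gam y w 0 = 0 by exact: lin0 ((lm_bilin LM y).2 w).
have h' w : (fun y : 'rV[R]_m => Gam y w 0) = cst 0 by apply/funext => y; exact: h.
by rewrite /curv !h !h' !tmapE !derive_cst subrr addr0 subr0.
Qed.

End LocalMetric.
End ChartGeometry.

(** * The second fundamental form *)

Fact hess_spec (R : realType) m n :
  {f : ('rV[R]_m -> 'rV[R]_n) -> 'rV[R]_m -> 'rV[R]_m -> 'rV[R]_m -> 'rV[R]_n |
    forall F x u v, f F x u v = 'D_u (fun y => tmap F y v) x}.
Proof. by exists (fun F x u v => 'D_u (fun y => tmap F y v) x). Qed.

Definition hess {R : realType} {m n} := sval (hess_spec R m n).

Lemma hessE {R : realType} {m n} (F : 'rV[R]_m -> 'rV[R]_n) x u v :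
  hess F x u v = 'D_u (fun y => tmap F y v) x.
Proof. exact: (svalP (hess_spec R m n)). Qed.

Definition sff_form {R : realType} {m n}
    (Gam : 'rV[R]_m -> 'rV[R]_m -> 'rV[R]_m -> 'rV[R]_m)
    (gam : 'rV[R]_n -> 'rV[R]_n -> 'rV[R]_n -> 'rV[R]_n)
    (F : 'rV[R]_m -> 'rV[R]_n) (x u v : 'rV[R]_m) : 'rV[R]_n :=
  hess F x u v + gam (F x) (tmap F x u) (tmap F x v) - tmap F x (Gam x u v).

Fact sff_spec (R : realType) m n :
  {f | forall Gam gam F x u v, f Gam gam F x u v = @sff_form R m n Gam gam F x u v}.
Proof. by exists (@sff_form R m n). Qed.

Section SecondFundamentalForm.
Context {R : realType} {m n : nat}.
Context {O : set 'rV[R]_m} {G : 'rV[R]_m -> 'M[R]_m}.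
Context {Gam : 'rV[R]_m -> 'rV[R]_m -> 'rV[R]_m -> 'rV[R]_m}.
Context {O' : set 'rV[R]_n} {g : 'rV[R]_n -> 'M[R]_n}.
Context {gam : 'rV[R]_n -> 'rV[R]_n -> 'rV[R]_n -> 'rV[R]_n}.
Hypothesis LM : local_metric O G Gam.
Hypothesis LM' : local_metric O' g gam.
Context {F : 'rV[R]_m -> 'rV[R]_n}.
Hypothesis FO : forall x, O x -> O' (F x).
Hypothesis F_smooth : forall k, Ck_on k O F.

Local Notation A := (tmap F).
Local Notation H := (hess F).

(* The second fundamental form nabla dF; dsff is its covariant derivative. *)
Definition sff : 'rV[R]_m -> 'rV[R]_m -> 'rV[R]_m -> 'rV[R]_n :=
  sval (sff_spec R m n) Gam gam F.

Lemma sffE x u v : sff x u v = H x u v + gam (F x) (A x u) (A x v) - A x (Gam x u v).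
Proof. exact: (svalP (sff_spec R m n)). Qed.

Definition dsff (x u v w : 'rV[R]_m) : 'rV[R]_n :=
  tmap (fun y : 'rV[R]_m => sff y v w) x u + gam (F x) (A x u) (sff x v w)
  - sff x (Gam x u v) w - sff x v (Gam x u w).

Let oO := lm_open LM.
Let oO' := lm_open LM'.

Lemma tmap_lin x : O x -> lin (fun u => A x u).
Proof. by move=> Ox; exact: tmap_lin_C1 oO Ox (F_smooth 1). Qed.

Lemma tmap_smooth k u : Ck_on k O (fun y : 'rV[R]_m => A y u).
Proof.
by rewrite (_ : A^~ u = 'D_u F); [exact: Ck_derive (F_smooth k.+1)|apply/funext => y; exact: tmapE].
Qed.

Lemma hess_sym x u v : O x -> H x u v = H x v u.
Proof.
have e v' : A^~ v' = 'D_v' F by apply/funext => y; exact: tmapE.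
move=> Ox; rewrite !hessE !e; exact: derive_comm oO Ox (F_smooth 2).
Qed.

Lemma hess_bilin x : O x -> bilin (fun u v => H x u v).
Proof.
move=> Ox; have h v : lin (fun u => H x u v).
  move=> c u w; rewrite !hessE; exact: derive_lin_dir oO Ox (tmap_smooth 1 v) c u w.
split; first exact: h.
by move=> u c v w; rewrite !(hess_sym u)//; exact: h.
Qed.

Lemma conn_tmap_smooth k u v : Ck_on k O (fun x => gam (F x) (A x u) (A x v)).
Proof.
apply: (@Ck_bilin _ _ _ _ _ _ _ _ (fun x => gam (F x))) => //.
- by move=> x _; exact: lm_bilin LM' _.
- move=> y z; exact: (Ck_comp_mx oO oO' FO (F_smooth k) (lm_conn_smooth LM' k y z)).
- exact: tmap_smooth.
- exact: tmap_smooth.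
Qed.

Lemma sff_smooth k u v : Ck_on k O (fun x => sff x u v).
Proof.
apply: (Ck_eq oO (fun x _ => esym (sffE x u v))).
apply: CkB => //; first apply: CkD => //.
- rewrite (_ : (fun x => H x u v) = 'D_u (A^~ v)).
    exact: Ck_derive (tmap_smooth k.+1 v).
  by apply/funext => y; exact: hessE.
- exact: conn_tmap_smooth.
- apply: (@Ck_lin _ _ _ _ _ _ _ (fun x w => A x w)) => //.
  + by move=> x Ox; exact: tmap_lin.
  + by move=> z; exact: tmap_smooth.
  + exact: lm_conn_smooth LM _ _ _.
Qed.

(** Second derivatives of [F] commute and both connections are torsion free. *)
Lemma sff_sym x u v : O x -> sff x u v = sff x v u.
Proof.
move=> Ox; rewrite !sffE (hess_sym u v Ox) (lm_torsion LM u v Ox).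
by rewrite (lm_torsion LM' (A x u) _ (FO Ox)).
Qed.

Lemma sff_bilin x : O x -> bilin (sff x).
Proof.
move=> Ox; have h v : lin (fun u => sff x u v).
  move=> c u w; rewrite !sffE (hess_bilin Ox).1 (tmap_lin Ox) (lm_bilin LM' _).1.
  rewrite (lm_bilin LM _).1 (tmap_lin Ox) !scalerDr scalerN.
  row_abel.
split; first exact: h.
by move=> u c v w; rewrite !(sff_sym u)//; exact: h.
Qed.

Section AlongMaps.
Context {E : normedModType R} (c : E -> 'rV[R]_m) (s d : E) (v : 'rV[R]_m).
Hypothesis Oc : \forall t \near s, O (c t).
Hypothesis dc : is_derive s d c v.

Let Os : O (c s). Proof. exact: nbhs_singleton Oc. Qed.

Lemma tmap_derive V V' : is_derive s d V V' ->
  is_derive s d (fun t => A (c t) (V t)) (H (c s) v (V s) + A (c s) V').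
Proof.
move=> dV.
have h z := is_derive_comp_C1 oO Os (tmap_smooth 1 z) dc.
have := @is_derive_lin_mx R E _ _ _ (fun t z => A (c t) z) V s d V'.
have [_ ->] := h (V s); rewrite -hessE; apply => //.
- by apply: filterS Oc => t; exact: tmap_lin.
Qed.

(** The second fundamental form is the defect in the commutation of dF with covariant
    differentiation: D(dF V) = dF(DV) + B(v,V). *)
Lemma tmap_covder V DV : covder Gam c v V s d DV ->
  covder gam (F \o c) (A (c s) v) (fun t => A (c t) (V t)) s d
    (A (c s) DV + sff (c s) v (V s)).
Proof.
move=> /tmap_derive; rewrite /covder /= sffE; congr is_derive.
rewrite (linB (tmap_lin Os)); row_abel.
Qed.

(** Leibniz rule for B along a map; it turns an identity satisfied by B along a curve into one for
    the tensor [dsff]. *)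
Lemma sff_covder V DV W DW :
  covder Gam c v V s d DV -> covder Gam c v W s d DW ->
  covder gam (F \o c) (A (c s) v) (fun t => sff (c t) (V t) (W t)) s d
    (dsff (c s) v (V s) (W s) + sff (c s) DV (W s) + sff (c s) (V s) DW).
Proof.
move=> dV dW.
have h y z := is_derive_comp_C1 oO Os (sff_smooth 1 y z) dc.
have := @is_derive_bilin_mx R E _ _ _ _ (fun t => sff (c t)) V W s d _ _ _ _ dV dW.
have -> : 'D_d (fun t => sff (c t) (V s) (W s)) s =
    tmap (fun y : 'rV[R]_m => sff y (V s) (W s)) (c s) v.
  by rewrite tmapE; have [_ ->] := h (V s) (W s).
rewrite /covder /= /dsff.
rewrite (linB ((sff_bilin Os).1 _)) (linB ((sff_bilin Os).2 _)) => K.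
apply: (@is_derive_eq _ _ _ _ _ _ _ _ (K _ _)).
- by apply: filterS Oc => t; exact: sff_bilin.
- by move=> y z; case: (h y z).
row_abel.
Qed.

End AlongMaps.

(** After antisymmetrization in the first two slots the third derivatives of [F] and the products of
    first and second derivatives cancel; the derivatives of the two connections combine with their
    quadratic terms into the two curvatures. *)
Lemma codazzi x u v w : O x ->
  dsff x u v w - dsff x v u w =
  curv gam (F x) (A x u) (A x v) (A x w) - A x (curv Gam x u v w).
Proof.
move=> Ox.
have nO := near_self LM Ox.
have lA := tmap_lin Ox.
have dconn a b : is_derive x a (fun y : 'rV[R]_m => gam (F y) (A y b) (A y w))
   (tmap (fun z : 'rV[R]_n => gam z (A x b) (A x w)) (F x) (A x a)
   + gam (F x) (H x a b) (A x w) + gam (F x) (A x b) (H x a w)).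
  have dF : is_derive x a F (A x a).
    by rewrite tmapE; apply: derivableP; exact: Ck_derivable (F_smooth 1) Ox.
  have h y z := is_derive_comp_C1 oO' (FO Ox) (lm_conn_smooth LM' 1 y z) dF.
  have dA z : is_derive x a (fun y => A y z) (H x a z).
    by rewrite hessE; apply: derivableP; exact: Ck_derivable (tmap_smooth 1 z) Ox.
  have := @is_derive_bilin_mx R _ _ _ _ _ (fun y => gam (F y)) _ _ x a _ _ _ _ (dA b) (dA w).
  have -> : 'D_a (fun y => gam (F y) (A x b) (A x w)) x =
      tmap (fun z : 'rV[R]_n => gam z (A x b) (A x w)) (F x) (A x a).
    by rewrite [RHS]tmapE; have [_ ->] := h (A x b) (A x w).
  apply.
    by apply: filterS nO => y _; exact: lm_bilin LM' _.
  by move=> y z; case: (h y z).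
have dGam a b : is_derive x a (fun y : 'rV[R]_m => A y (Gam y b w))
   (H x a (Gam x b w) + A x (tmap (fun y : 'rV[R]_m => Gam y b w) x a)).
  have dG : is_derive x a (fun y : 'rV[R]_m => Gam y b w)
      (tmap (fun y : 'rV[R]_m => Gam y b w) x a).
    by rewrite tmapE; apply: derivableP; exact: Ck_derivable (lm_conn_smooth LM 1 b w) Ox.
  exact: tmap_derive nO (is_derive_id _ _) _ _ dG.
have dH b : (fun y : 'rV[R]_m => H y b w) = 'D_b (A^~ w).
  by apply/funext => y; exact: hessE.
have sh b : Ck_on 1 O (fun y : 'rV[R]_m => H y b w).
  by rewrite dH; exact: Ck_derive (tmap_smooth 2 w).
have dsE a b : tmap (fun y : 'rV[R]_m => sff y b w) x a =
    tmap (fun y : 'rV[R]_m => H y b w) x a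
    + (tmap (fun z : 'rV[R]_n => gam z (A x b) (A x w)) (F x) (A x a)
       + gam (F x) (H x a b) (A x w) + gam (F x) (A x b) (H x a w))
    - (H x a (Gam x b w) + A x (tmap (fun y : 'rV[R]_m => Gam y b w) x a)).
  have k1 : derivable (fun y : 'rV[R]_m => H y b w) x a by exact: Ck_derivable (sh b) Ox.
  rewrite [LHS]tmapE [X in X + _ - _]tmapE.
  have -> : (fun y : 'rV[R]_m => sff y b w) = (fun y : 'rV[R]_m =>
      H y b w + gam (F y) (A y b) (A y w) - A y (Gam y b w)).
    by apply/funext => y; exact: sffE.
  have [_ e] := is_deriveB (is_deriveD (derivableP k1) (dconn a b)) (dGam a b).
  exact: e.
(* Symmetry of the third derivative of [F] in its two outer directions. *)
have sch : tmap (fun y : 'rV[R]_m => H y v w) x u = tmap (fun y : 'rV[R]_m => H y u w) x v.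
  have c a b : tmap (fun y : 'rV[R]_m => H y b w) x a = 'D_a ('D_b (A^~ w)) x.
    apply: (etrans (tmapE _ _ _)); exact: (congr1 (fun f => 'D_a f x) (dH b)).
  apply: (etrans (c u v)); apply: (etrans _ (esym (c v u))).
  exact: (@derive_comm R _ _ _ (A^~ w) O x v u oO Ox (tmap_smooth 2 w)).
have l1 a := linD ((lm_bilin LM' (F x)).2 a); have l2 a := linN ((lm_bilin LM' (F x)).2 a).
rewrite /dsff (dsE u v) (dsE v u) sch.
rewrite (hess_sym u v Ox).
rewrite (lm_torsion LM u v Ox).
rewrite /curv !sffE !(linD lA) !(linN lA) !l1 !l2.
rewrite (lm_torsion LM' (A x v) (H x u w) (FO Ox)) (lm_torsion LM' (A x u) (H x v w) (FO Ox)).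
rewrite (hess_sym v u Ox).
row_abel.
Qed.

End SecondFundamentalForm.

(** * Horizontal curves of a submersion of open sets *)

Lemma derive_near0 {R : realType} (W : normedModType R) (f : R -> W) s :
  (\forall t \near s, f t = 0) -> 'D_1 f s = 0.
Proof.
move=> f0; have e : \forall t \near s, f t = cst 0 t by [].
rewrite (near_eq_derive _ e); exact: derive_cst.
Qed.

Section LocalSubmersion.
Context {R : realType} {m n : nat}.

(* For a Riemannian submersion this characterizes the horizontal vectors; for a
   change of charts, an isometry, it holds for all h. *)
Definition hor_in_chart (G : 'rV[R]_m -> 'M[R]_m) (g : 'rV[R]_n -> 'M[R]_n)
    (F : 'rV[R]_m -> 'rV[R]_n) (x h : 'rV[R]_m) : Prop :=
  forall z, inner (G x) h z = inner (g (F x)) (tmap F x h) (tmap F x z).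

(** [P] acts on row vectors from the right and is the orthogonal projection to the horizontal space,
    determined by [ls_proj] and [ls_hor]. It serves to extend a horizontal vector to a horizontal
    field along a line, where it is differentiated once; hence only C^1 is required. *)
Record local_submersion (O : set 'rV[R]_m) (G : 'rV[R]_m -> 'M[R]_m)
    (Gam : 'rV[R]_m -> 'rV[R]_m -> 'rV[R]_m -> 'rV[R]_m)
    (O' : set 'rV[R]_n) (g : 'rV[R]_n -> 'M[R]_n)
    (gam : 'rV[R]_n -> 'rV[R]_n -> 'rV[R]_n -> 'rV[R]_n)
    (F : 'rV[R]_m -> 'rV[R]_n) (P : 'rV[R]_m -> 'M[R]_m) : Prop := LocalSubmersion {
  ls_src : local_metric O G Gam ;
  ls_tgt : local_metric O' g gam ;
  ls_maps : forall x, O x -> O' (F x) ;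
  ls_smooth : forall k, Ck_on k O F ;
  ls_surj : forall x y, O x -> exists z, tmap F x z = y ;
  ls_projC1 : Ck_on 1 O P ;
  ls_proj : forall x u, O x -> tmap F x (u *m P x) = tmap F x u ;
  ls_hor : forall x u, O x -> hor_in_chart G g F x (u *m P x)
}.

Context {O : set 'rV[R]_m} {G : 'rV[R]_m -> 'M[R]_m}.
Context {Gam : 'rV[R]_m -> 'rV[R]_m -> 'rV[R]_m -> 'rV[R]_m}.
Context {O' : set 'rV[R]_n} {g : 'rV[R]_n -> 'M[R]_n}.
Context {gam : 'rV[R]_n -> 'rV[R]_n -> 'rV[R]_n -> 'rV[R]_n}.
Context {F : 'rV[R]_m -> 'rV[R]_n} {P : 'rV[R]_m -> 'M[R]_m}.
Hypothesis LS : local_submersion O G Gam O' g gam F P.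

Let LM := ls_src LS.
Let LM' := ls_tgt LS.
Let FO := ls_maps LS.
Let Fs := ls_smooth LS.
Let oO := lm_open LM.

Local Notation A := (tmap F).
Local Notation B := (sff (Gam := Gam) (gam := gam) (F := F)).
Local Notation DB := (dsff (Gam := Gam) (gam := gam) (F := F)).
Local Notation hor := (hor_in_chart G g F).

(* For z vertical and h, k horizontal, [sff_inner x z h k] is <A_h k, z>, with A
   the integrability tensor of O'Neill. *)
Definition sff_inner x u v w := inner (g (F x)) (B x u v) (A x w).
Local Notation om := sff_inner.

Let lA x (Ox : O x) := tmap_lin LM Fs Ox.
Let bB x (Ox : O x) := sff_bilin LM LM' FO Fs Ox.

Lemma ip_sym x u v : O x -> inner (G x) u v = inner (G x) v u.
Proof. by move=> /(lm_sym LM); exact: inner_sym. Qed.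

Lemma ip'_sym x u v : O x -> inner (g (F x)) u v = inner (g (F x)) v u.
Proof. by move=> /FO/(lm_sym LM'); exact: inner_sym. Qed.

Lemma om_sym x u v w : O x -> om x u v w = om x v u w.
Proof. by move=> Ox; rewrite /om (sff_sym LM LM' FO Fs u v Ox). Qed.

Lemma omD1 x u u' v w : O x -> om x (u + u') v w = om x u v w + om x u' v w.
Proof. by move=> Ox; rewrite /om (linD ((bB Ox).1 v)) innerE. Qed.

Lemma omB1 x u u' v w : O x -> om x (u - u') v w = om x u v w - om x u' v w.
Proof. by move=> Ox; rewrite /om (linB ((bB Ox).1 v)) !innerE. Qed.

Lemma horD x h k : O x -> hor x h -> hor x k -> hor x (h + k).
Proof. by move=> Ox hh hk z; rewrite (linD (lA Ox)) !innerE hh hk. Qed.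

Lemma horN x h : O x -> hor x h -> hor x (- h).
Proof. by move=> Ox hh z; rewrite (linN (lA Ox)) !innerE hh. Qed.

Lemma hor_vert_eq0 x h : O x -> hor x h -> A x h = 0 -> h = 0.
Proof.
move=> Ox hh Ah; apply: (inner_eq0 LM Ox); by rewrite hh Ah inner0l.
Qed.

Lemma hor_fix x h : O x -> hor x h -> h *m P x = h.
Proof.
move=> Ox hh; apply/eqP; rewrite -subr_eq0; apply/eqP.
apply: (hor_vert_eq0 Ox); first by apply: horD => //; [exact: ls_hor LS _ _ Ox|exact: horN].
by rewrite (linB (lA Ox)) (ls_proj LS _ Ox) subrr.
Qed.

Lemma vert_part_vert x u : O x -> A x (u - u *m P x) = 0.
Proof. by move=> Ox; rewrite (linB (lA Ox)) (ls_proj LS _ Ox) subrr. Qed.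

(** The vector z is extended by constant components. Its covariant derivative Gam(v,z) is paired
    with V upstairs and with dF V downstairs; since V is horizontal the two contributions agree and
    cancel. *)
Lemma hor_covder c (s : R) v V DV z :
  O (c s) -> is_derive s 1 c v -> covder Gam c v V s 1 DV ->
  (\forall t \near s, hor (c t) (V t)) ->
  om (c s) v (V s) z + om (c s) v z (V s) =
  inner (G (c s)) DV z - inner (g (F (c s))) (A (c s) DV) (A (c s) z).
Proof.
move=> Oc dc dV hV.
have nO := near_open_derive oO Oc dc.
have dF : is_derive s 1 (F \o c) (A (c s) v).
  by rewrite tmapE; exact: (is_derive_comp_C1 oO Oc (Fs 1) dc).
have [_ e1] := inner_compat LM Oc dc dV (covder_cst c s 1 v z).
have [_ e2] := inner_compat LM' (FO Oc : O' ((F \o c) s)) dF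
  (tmap_covder (gam := gam) LM Fs nO dc dV)
  (tmap_covder (gam := gam) LM Fs nO dc (covder_cst c s 1 v z)).
have e : 'D_1 (fun t => inner (G (c t)) (V t) z) s =
    'D_1 (fun t => inner (g ((F \o c) t)) (A (c t) (V t)) (A (c t) z)) s.
  by apply: near_eq_derive; apply: filterS hV => t /(_ z).
move: e; rewrite e1 e2 /= (nbhs_singleton hV) /om !innerE.
rewrite (ip'_sym (A (c s) (V s)) (B (c s) v z) Oc) => e.
move: e; inner_lra.
Qed.

(** A horizontal field is needed in arbitrary directions [u], not only along a given curve: the
    constant vector [h] is projected at each point of a straight line. *)
Lemma hor_extension_line x (u h : 'rV[R]_m) : O x -> hor x h ->
  exists (c V : R -> 'rV[R]_m) DV, [/\ c 0 = x, V 0 = h, is_derive (0 : R) 1 c u,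
    covder Gam c u V (0 : R) 1 DV & \forall t \near (0 : R), hor (c t) (V t)].
Proof.
move=> Ox hh; pose c (t : R) := x + t *: u.
have c0 : c 0 = x by rewrite /c scale0r addr0.
have dc : is_derive (0 : R) 1 c u.
  by apply: (@is_derive_line R _ _ id x u 0 u); exact: (is_derive_id (x + 0 *: u) u).
have Oc : O (c 0) by rewrite c0.
pose V t := h *m P (c t).
have V0 : V 0 = h by rewrite /V c0 hor_fix.
have hC : Ck_on 1 O (fun y => h *m P y).
  by apply: Ck_mulmx => //; [exact: Ck_cst|exact: ls_projC1 LS].
have dV := is_derive_comp_C1 oO Oc hC dc.
exists c, V, ('D_u (fun y => h *m P y) (c 0) + Gam (c 0) u (V 0)); split=> //.
  by rewrite /covder addrK.
apply: filterS (near_open_derive oO Oc dc) => t Ot; exact: ls_hor LS _ _ Ot.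
Qed.

(** By [hor_covder] the sum of both sides is <DV, k> - <dF DV, dF k>, which vanishes because k is
    horizontal too. *)
Lemma om_anti x u h k : O x -> hor x h -> hor x k -> om x u h k = - om x u k h.
Proof.
move=> Ox hh hk; have [c [V [DV [c0 V0 dc dV hV]]]] := hor_extension_line u Ox hh.
have Oc : O (c 0) by rewrite c0.
have := hor_covder k Oc dc dV hV; rewrite c0 V0 => e.
apply/eqP; rewrite -addr_eq0 e; apply/eqP.
by rewrite (ip_sym DV k Ox) hk (ip'_sym _ _ Ox) subrr.
Qed.

Lemma om_diag x u h : O x -> hor x h -> om x u h h = 0.
Proof.
move=> Ox hh; have := om_anti u Ox hh hh; move: (om x u h h) => y e.
lra.
Qed.

(** On horizontal vectors [sff_inner] is symmetric in its first two arguments and antisymmetric in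
    its last two; such a trilinear form is zero, as in the uniqueness of the Levi-Civita
    connection. *)
Lemma sff_hor x h k : O x -> hor x h -> hor x k -> B x h k = 0.
Proof.
move=> Ox hh hk.
have h0 l : hor x l -> om x h k l = 0.
  move=> hl; have e1 := om_anti h Ox hk hl; have e2 := om_anti l Ox hh hk.
  have e3 := om_anti k Ox hl hh.
  rewrite (om_sym k l)// in e3; rewrite (om_sym h l)// in e1.
  rewrite (om_sym k h)// in e3.
  move: e1 e2 e3; move: (om x h k l) (om x l h k) (om x l k h) => a b d.
  move=> *; lra.
(* As dF is onto, B(h,k) is the image of some z, which may be replaced by its horizontal part; so
   B(h,k) is orthogonal to itself. *)
have [z ez] := ls_surj LS (B x h k) Ox.
apply: (inner_eq0 LM' (FO Ox)).
rewrite -[X in inner _ _ X]ez -(ls_proj LS z Ox).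
by apply: h0; exact: ls_hor LS _ _ Ox.
Qed.

Lemma om_hor x h k w : O x -> hor x h -> hor x k -> om x h k w = 0.
Proof. by move=> Ox hh hk; rewrite /om sff_hor// inner0l. Qed.

Lemma covder_eq0 (w q : R -> 'rV[R]_n) k s y :
  covder gam q k w s 1 y -> (\forall t \near s, w t = 0) -> y = 0.
Proof.
move=> [_ e1] w0.
by move: e1; rewrite (derive_near0 w0) (nbhs_singleton w0) (lin0 ((lm_bilin LM' _).2 _)) subr0.
Qed.

(** * The cubic equation along a horizontal curve *)

Section Curve.
Context {J : set R} {c v a b Db : R -> 'rV[R]_m}.
Hypothesis oJ : open J.
Hypothesis cO : forall s, J s -> O (c s).
Hypothesis dc : forall s, J s -> is_derive s 1 c (v s).
Hypothesis dv : forall s, J s -> covder Gam c (v s) v s 1 (a s).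
Hypothesis da : forall s, J s -> covder Gam c (v s) a s 1 (b s).
Hypothesis db : forall s, J s -> covder Gam c (v s) b s 1 (Db s).
Hypothesis hv : forall s, J s -> hor (c s) (v s).

Let nJ s : J s -> \forall t \near s, J t.
Proof. by move=> Js; exact: open_nbhs_nbhs. Qed.

Let nO s : J s -> \forall t \near s, O (c t).
Proof. by move=> Js; apply: filterS (nJ Js). Qed.

(** In [hor_covder] with V = v both terms on the left vanish: B(v,v) = 0, and om(v,z,v) = om(z,v,v)
    = 0 by antisymmetry. *)
Lemma acc_hor s : J s -> hor (c s) (a s).
Proof.
move=> Js z; have Os := cO Js.
have nh : \forall t \near s, hor (c t) (v t) by apply: filterS (nJ Js).
have := hor_covder z Os (dc Js) (dv Js) nh.
rewrite om_hor; [|exact: Os|exact: hv|exact: hv].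
rewrite (om_sym _ z)// om_diag//; last exact: hv.
by rewrite addr0 => /esym/eqP; rewrite subr_eq0 => /eqP.
Qed.

(** This is [hor_covder] for the horizontal field a, where B(v,a) = 0. For vertical z the right side
    is <b,z>, so the left side detects the vertical part of b. *)
Lemma om_jerk s z : J s -> om (c s) (v s) z (a s) =
  inner (G (c s)) (b s) z - inner (g (F (c s))) (A (c s) (b s)) (A (c s) z).
Proof.
move=> Js; have Os := cO Js.
have nh : \forall t \near s, hor (c t) (a t) by apply: filterS (nJ Js) => t; exact: acc_hor.
rewrite -(hor_covder z Os (dc Js) (da Js) nh) (om_hor z Os (hv Js) (acc_hor Js)).
by rewrite add0r.
Qed.

Lemma base_derive s : J s -> is_derive s 1 (F \o c) (A (c s) (v s)).
Proof.
by move=> Js; rewrite tmapE; exact: (is_derive_comp_C1 oO (cO Js) (Fs 1) (dc Js)).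
Qed.

Lemma base_vel s : J s ->
  covder gam (F \o c) (A (c s) (v s)) (fun t => A (c t) (v t)) s 1 (A (c s) (a s)).
Proof.
move=> Js; have := tmap_covder (gam := gam) LM Fs (nO Js) (dc Js) (dv Js).
by rewrite sff_hor ?addr0//; try exact: cO; exact: hv.
Qed.

Lemma base_acc s : J s ->
  covder gam (F \o c) (A (c s) (v s)) (fun t => A (c t) (a t)) s 1 (A (c s) (b s)).
Proof.
move=> Js; have := tmap_covder (gam := gam) LM Fs (nO Js) (dc Js) (da Js).
by rewrite sff_hor ?addr0//; [exact: cO|exact: hv|exact: acc_hor].
Qed.

Lemma base_jerk s : J s ->
  covder gam (F \o c) (A (c s) (v s)) (fun t => A (c t) (b t)) s 1
    (A (c s) (Db s) + B (c s) (v s) (b s)).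
Proof. move=> Js; exact: (tmap_covder (gam := gam) LM Fs (nO Js) (dc Js) (db Js)). Qed.

Definition cubic s := Db s + curv Gam (c s) (a s) (v s) (v s).

(** The cubic expression of the projected curve: by [base_jerk] the first two summands are the
    covariant derivative of dF b. The term B(v,b) stays because b need not be horizontal. *)
Definition base_cubic s := A (c s) (Db s) + B (c s) (v s) (b s)
  + curv gam (F (c s)) (A (c s) (a s)) (A (c s) (v s)) (A (c s) (v s)).

(** The identity B(a,v) = 0 is differentiated along the curve; the term B(a,a) vanishes as well. *)
Lemma dsff_vav s : J s -> DB (c s) (v s) (a s) (v s) = - B (c s) (b s) (v s).
Proof.
move=> Js.
have n0 : \forall t \near s, B (c t) (a t) (v t) = 0.
  apply: filterS (nJ Js) => t Jt; apply: sff_hor; [exact: cO|exact: acc_hor|exact: hv].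
have := covder_eq0 (sff_covder LM LM' FO Fs (nO Js) (dc Js) (da Js) (dv Js)) n0.
rewrite (sff_hor (cO Js) (acc_hor Js) (acc_hor Js)) addr0 => /eqP.
by rewrite addr_eq0 => /eqP.
Qed.

(* The field V extends v s horizontally in the direction a s; its covariant
   derivative y differs from - b s by a horizontal vector. *)
Lemma dsff_avv s : J s -> DB (c s) (a s) (v s) (v s) = 2 *: B (c s) (b s) (v s).
Proof.
move=> Js; have Os := cO Js.
have [k [V [y [k0 V0 dk dV hV]]]] := hor_extension_line (a s) Os (hv Js).
have Ok : O (k 0) by rewrite k0.
have nOk := near_open_derive oO Ok dk.
have n0 : \forall t \near (0 : R), B (k t) (V t) (V t) = 0.
  near=> t; have ht : hor (k t) (V t) by near: t.
  by apply: sff_hor => //; near: t.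
have := covder_eq0 (sff_covder LM LM' FO Fs nOk dk dV dV) n0.
rewrite k0 V0 (sff_sym LM LM' FO Fs (v s) y Os).
(* In [hor_covder] for V in direction a, the remaining term om(a,z,v) equals -om(v,z,a), which is
   the negative of the expression of [om_jerk]; the obstructions of y and b thus cancel. *)
have hyb : hor (c s) (y + b s).
  move=> z; have := hor_covder z Ok dk dV hV; rewrite k0 V0.
  rewrite om_hor ?add0r//; [|exact: acc_hor|exact: hv].
  have := om_jerk z Js.
  rewrite (om_sym _ z)// (om_sym (a s))// (om_anti z Os (acc_hor Js) (hv Js)).
  rewrite (linD (lA Os)) !innerE; move: (om (c s) z (v s) (a s)) => p.
  inner_lra.
have -> : B (c s) y (v s) = - B (c s) (b s) (v s).
  by apply/eqP; rewrite -addr_eq0 -(linD ((bB Os).1 _)) sff_hor//; exact: hv.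
move=> e; have -> : 2 *: B (c s) (b s) (v s) = B (c s) (b s) (v s) + B (c s) (b s) (v s).
  by rewrite scaler_nat.
apply/eqP; rewrite -subr_eq0 -[X in _ == X]e; apply/eqP; row_abel.
Unshelve. all: by end_near. Qed.

(** One B(b,v) comes from the third covariant derivative, and 2 + 1 more from the two covariant
    derivatives of B in the Codazzi equation. *)
Lemma tmap_cubic s : J s ->
  A (c s) (cubic s) = base_cubic s - 4 *: B (c s) (b s) (v s).
Proof.
move=> Js; have Os := cO Js.
have := codazzi LM LM' FO Fs (a s) (v s) (v s) Os.
rewrite dsff_vav// dsff_avv// => e.
rewrite /cubic /base_cubic (linD (lA Os) (Db s)).
rewrite (sff_sym LM LM' FO Fs (v s) (b s) Os).
have -> : A (c s) (curv Gam (c s) (a s) (v s) (v s)) =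
   curv gam (F (c s)) (A (c s) (a s)) (A (c s) (v s)) (A (c s) (v s))
   - (2 *: B (c s) (b s) (v s) - - B (c s) (b s) (v s)).
  by rewrite e opprB addrC subrK.
have -> : 4 = 2 + 1 + 1 :> R by ring.
rewrite !scalerDl scale1r; row_abel.
Qed.

(** Both equations at s give B(b,v) = 0. Tested against dF a this kills the vertical part of b, and
    for horizontal b the right side of [om_jerk] is zero for every z. *)
Lemma cubic_om0 s z : J s -> base_cubic s = 0 -> cubic s = 0 ->
  om (c s) z (v s) (a s) = 0.
Proof.
move=> Js q0 q1; have Os := cO Js.
have := tmap_cubic Js; rewrite q0 q1 (lin0 (lA Os)) sub0r => /esym/eqP.
rewrite oppr_eq0 scaler_eq0 (_ : (4 == 0 :> R) = false); last first.
  by apply/negbTE; rewrite pnatr_eq0.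
rewrite /= => /eqP Bbv.
have b0 : om (c s) (b s) (v s) (a s) = 0 by rewrite /om Bbv inner0l.
pose w := b s - b s *m P (c s).
have Aw : A (c s) w = 0 by exact: vert_part_vert.
have hb : hor (c s) (b s *m P (c s)) by exact: (ls_hor LS _ Os).
have w0 : om (c s) w (v s) (a s) = 0.
  by rewrite /w omB1// b0 (om_hor _ Os hb (hv Js)) subrr.
(* By [om_jerk], <b,w> = om(v,w,a) = 0 for the vertical part w of b, and <b,w> is the squared norm
   of w. *)
have ww : w = 0.
  apply: (inner_eq0 LM Os).
  have := om_jerk w Js; rewrite om_sym// w0 Aw inner0r subr0 => e.
  have := hb w; rewrite Aw inner0r => e2.
  have := innerDl (G (c s)) (b s) (- (b s *m P (c s))) w.
  by rewrite innerNl -e e2 subrr.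
have hbs : hor (c s) (b s).
  by move/eqP: ww; rewrite /w subr_eq0 => /eqP ->.
by rewrite om_sym// om_jerk// hbs subrr.
Qed.

(** The hypothesis makes the cubic expression S vertical. Then <S,S> is the sum of <Db,S> =
    om(v,S,b), by [hor_covder], and <R(a,v)v,S> = -<v,R(a,v)S> = om(b,S,v), by Codazzi; the two
    cancel by antisymmetry. The condition is assumed on all of J because it is differentiated. *)
Lemma om0_cubic s : J s -> base_cubic s = 0 ->
  (forall t, J t -> forall z, A (c t) z = 0 -> om (c t) z (v t) (a t) = 0) ->
  cubic s = 0.
Proof.
move=> Js q0 H0.
(* Horizontal z give zero automatically, so the condition on vertical z extends to all z, in
   particular to constant fields, which do not stay vertical. *)
have H t z : J t -> om (c t) z (v t) (a t) = 0.
  move=> Jt; have Ot := cO Jt.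
  rewrite -[z](subrK (z *m P (c t))) omD1// H0//; last exact: vert_part_vert.
  rewrite add0r om_hor//; [exact: (ls_hor LS _ Ot)|exact: hv].
have hb t : J t -> hor (c t) (b t).
  move=> Jt z; apply/eqP; rewrite -subr_eq0 -om_jerk// om_sym; last exact: cO.
  by rewrite H.
have Os := cO Js.
have AS : A (c s) (cubic s) = 0.
  rewrite tmap_cubic// q0 sff_hor//; [|exact: hb|exact: hv].
  by rewrite scaler0 subrr.
have H' t z : J t -> om (c t) z (a t) (v t) = 0.
  move=> Jt; rewrite (om_anti _ (cO Jt) (acc_hor Jt) (hv Jt)) H ?oppr0//.
(* Derivative of om(a,z,v) = 0 along the curve with z constant: the term with Gam(v,z) vanishes by
   hypothesis and om(a,z,a) by antisymmetry, leaving om(b,z,v). *)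
have d1 z : inner (g (F (c s))) (DB (c s) (v s) (a s) z) (A (c s) (v s)) =
    - om (c s) (b s) z (v s).
  have n0 : \forall t \near s, inner (g ((F \o c) t)) (B (c t) (a t) z) (A (c t) (v t)) = 0.
    apply: filterS (nJ Js) => t Jt; have := H' t z Jt.
    by rewrite (om_sym z); [|exact: cO].
  have k1 := sff_covder LM LM' FO Fs (nO Js) (dc Js) (da Js) (covder_cst c s 1 (v s) z).
  have [_ e] := inner_compat LM' (FO Os : O' ((F \o c) s)) (base_derive Js) k1 (base_vel Js).
  have := derive_near0 n0; rewrite e /= !innerE.
  rewrite -![inner _ (B _ _ _) _]/(om _ _ _ _).
  rewrite (om_sym (a s) (Gam (c s) (v s) z))// H'//.
  rewrite (om_sym (a s) z)// om_diag//; last exact: acc_hor.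
  rewrite !addr0 => /eqP; rewrite addr_eq0 => /eqP ->; exact: erefl.
(* Derivative of om(V,z,V) = 0 in the direction a, with V a horizontal extension of v. Under the
   hypothesis the covariant derivative y of V is itself horizontal, so om(y,z,v) and om(v,z,y)
   cancel. *)
have d2 z : inner (g (F (c s))) (DB (c s) (a s) (v s) z) (A (c s) (v s)) = 0.
  have [k [V [y [k0 V0 dk dV hV]]]] := hor_extension_line (a s) Os (hv Js).
  have Ok : O (k 0) by rewrite k0.
  have nOk := near_open_derive oO Ok dk.
  have n0 : \forall t \near (0 : R), inner (g ((F \o k) t)) (B (k t) (V t) z) (A (k t) (V t)) = 0.
    near=> t; have ht : hor (k t) (V t) by near: t.
    have Ot : O (k t) by near: t.
    rewrite -[LHS]/(om _ _ _ _) om_sym//; exact: om_diag.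
  have hy : hor (c s) y.
    move=> z'; have := hor_covder z' Ok dk dV hV; rewrite k0 V0.
    rewrite om_hor//; [|exact: acc_hor|exact: hv].
    by rewrite om_sym// H' // addr0 => /esym/eqP; rewrite subr_eq0 => /eqP.
  have dF : is_derive (0 : R) 1 (F \o k) (A (k 0) (a s)).
    by rewrite tmapE; exact: (is_derive_comp_C1 oO Ok (Fs 1) dk).
  have k1 := sff_covder LM LM' FO Fs nOk dk dV (covder_cst k 0 1 (a s) z).
  have k2 := tmap_covder (gam := gam) LM Fs nOk dk dV.
  have [_ e] := inner_compat LM' (FO Ok : O' ((F \o k) 0)) dF k1 k2.
  have := derive_near0 n0; rewrite e /= k0 V0.
  rewrite (sff_hor Os (acc_hor Js) (hv Js)) addr0 !innerE.
  rewrite -![inner _ (B _ _ _) _]/(om _ _ _ _).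
  rewrite (om_sym (v s))// om_diag//; last exact: hv.
  rewrite (om_sym y)// (om_sym (v s))// (om_anti z Os hy (hv Js)) addr0.
  by rewrite addrNK.
apply: (inner_eq0 LM Os); set S := cubic s in AS *.
have nh : \forall t \near s, hor (c t) (b t) by apply: filterS (nJ Js).
have := hor_covder S Os (dc Js) (db Js) nh.
rewrite om_hor//; [|exact: hv|exact: hb].
rewrite AS inner0r subr0 add0r => e1.
have := codazzi LM LM' FO Fs (a s) (v s) S Os.
rewrite AS (curv0 LM') sub0r => e2.
have e3 : inner (G (c s)) (v s) (curv Gam (c s) (a s) (v s) S) = - om (c s) (b s) S (v s).
  rewrite hv// ip'_sym// -[X in inner _ X _]opprK -e2 innerNl innerDl innerNl.
  by rewrite d1 d2 add0r opprK.
rewrite {1}/S /cubic innerDl -e1 (curv_anti LM)// e3 opprK.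
rewrite om_sym// (om_sym (b s))// (om_anti S Os (hv Js) (hb _ Js)) addrC subrr.
by [].
Unshelve. all: by end_near. Qed.

End Curve.
End LocalSubmersion.

(** * Tangent vectors and metrics in charts *)

Arguments dom_open {R n m} i.
Arguments cod_open {R n m} i.

Section TangentVectors.
Context {R : realType} {n : nat} {M : manifold R n}.
Implicit Types (i j : chart M) (p : M).

Definition trans i j : 'rV[R]_n -> 'rV[R]_n := phi j \o psi i.

Lemma psi_dom i x (W : set M) : (phi i @` (dom i `&` W)) x ->
  [/\ dom i (psi i x), W (psi i x) & phi i (psi i x) = x].
Proof. by move=> [p [dp Wp] <-]; rewrite phiK. Qed.

Lemma chart_image_sub i (W : set M) : phi i @` (dom i `&` W) `<=` phi i @` dom i.
Proof. by move=> x [p [dp _] <-]; exists p. Qed.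

Lemma chart_image_open i (W : set M) : open W -> open (phi i @` (dom i `&` W)).
Proof.
move=> oW; rewrite openE => x xW; have [dx Wx ex] := psi_dom xW.
have xc : (phi i @` dom i) x by exact: chart_image_sub xW.
have nW : \forall y \near x, W (psi i y).
  by apply: (psi_continuous xc); exact: open_nbhs_nbhs.
have nc : \forall y \near x, (phi i @` dom i) y.
  by apply: open_nbhs_nbhs; split=> //; exact: cod_open.
rewrite /interior; near=> y.
have [p dp ey] : (phi i @` dom i) y by near: y.
exists p => //; split=> //; rewrite -(phiK dp) ey; near: y; exact: nW.
Unshelve. all: by end_near. Qed.

Arguments chart_image_open i {W} _.

Lemma near_chart_image i p (W : set M) : open W -> dom i p -> W p ->
  \forall x \near phi i p, (phi i @` (dom i `&` W)) x.
Proof.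
move=> oW dp Wp; apply: open_nbhs_nbhs; split; first exact: chart_image_open.
by exists p.
Qed.

Lemma trans_smooth k i j : Ck_on k (phi i @` (dom i `&` dom j)) (trans i j).
Proof. exact: transition_smooth. Qed.

Lemma transE i j p : dom i p -> trans i j (phi i p) = phi j p.
Proof. by move=> dp; rewrite /trans /= phiK. Qed.

Lemma trans_differentiable i j p : dom i p -> dom j p ->
  differentiable (trans i j) (phi i p).
Proof.
move=> di dj; have W : (phi i @` (dom i `&` dom j)) (phi i p) by exists p.
exact: (differentiable_C1_mx (chart_image_open i (dom_open j)) W (trans_smooth 1 i j)).
Qed.

Lemma tmap_trans_lin i j p : dom i p -> dom j p -> lin (tmap (trans i j) (phi i p)).
Proof.
move=> di dj; have W : (phi i @` (dom i `&` dom j)) (phi i p) by exists p.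
exact: (tmap_lin_C1 (chart_image_open i (dom_open j)) W (trans_smooth 1 i j)).
Qed.

Lemma trans_is_derive i j p u : dom i p -> dom j p ->
  is_derive (phi i p) u (trans i j) (tmap (trans i j) (phi i p) u).
Proof.
by move=> di dj; rewrite tmapE; apply/derivableP/diff_derivable; exact: trans_differentiable.
Qed.

Lemma tmap_trans_comp i j (k : chart M) p u : dom i p -> dom j p -> dom k p ->
  tmap (trans j k) (phi j p) (tmap (trans i j) (phi i p) u) = tmap (trans i k) (phi i p) u.
Proof.
move=> di dj dk.
have dg : differentiable (trans j k) (trans i j (phi i p)).
  by rewrite transE//; exact: trans_differentiable.
have [_] := is_derive_comp_diff (trans_is_derive u di dj) dg.
rewrite transE// => e; rewrite [LHS]tmapE -e [RHS]tmapE; apply: near_eq_derive.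
apply: filterS (near_chart_image (dom_open j) di dj) => x xW.
by have [d1 d2 _] := psi_dom xW; rewrite /trans /= phiK.
Qed.

Lemma tmap_trans_id i p u : dom i p -> tmap (trans i i) (phi i p) u = u.
Proof.
move=> di; rewrite tmapE -[RHS](derive_id (phi i p)); apply: near_eq_derive.
apply: filterS (near_chart_image (dom_open i) di di) => x xW.
by have [_ _ e] := psi_dom xW.
Qed.

Lemma tangent_trans p (v : tvec M) i j : tangent p v -> dom i p -> dom j p ->
  v j = tmap (trans i j) (phi i p) (v i).
Proof. by move=> [_ tv] di dj; rewrite tmapE; exact: tv. Qed.

(** One component determines those in the other charts around p by the transition maps; in all
    remaining charts both families are 0 by convention. *)
Lemma tangent_inj p (u v : tvec M) i : tangent p u -> tangent p v -> dom i p ->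
  u i = v i -> u = v.
Proof.
move=> tu tv di e; apply/funext => j; have [dj|ndj] := pselect (dom j p).
  by rewrite (tangent_trans tu di dj) (tangent_trans tv di dj) e.
by rewrite tu.1// tv.1.
Qed.

Lemma at_point_in p (c : tvec M) i : dom i p -> at_point p c i = c i.
Proof. by move=> di; rewrite /at_point asboolT. Qed.

Lemma at_point_out p (c : tvec M) i : ~ dom i p -> at_point p c i = 0.
Proof. by move=> di; rewrite /at_point asboolF. Qed.

Lemma tvec_ofE i u p j : dom j p -> tvec_of i u p j = tmap (trans i j) (phi i p) u.
Proof. by move=> dj; rewrite /tvec_of at_point_in// tmapE. Qed.

Lemma tvec_of_id i u p : dom i p -> tvec_of i u p i = u.
Proof. by move=> di; rewrite tvec_ofE// tmap_trans_id. Qed.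

Lemma tvec_of_tangent i u p : dom i p -> tangent p (tvec_of i u p).
Proof.
move=> di; split=> [j ndj|j k dj dk]; first exact: at_point_out.
by rewrite -tmapE !tvec_ofE// tmap_trans_comp.
Qed.

Lemma tvec_of_tangentE i (v : tvec M) p : dom i p -> tangent p v -> tvec_of i (v i) p = v.
Proof.
move=> di tv; apply: (tangent_inj (tvec_of_tangent _ di) tv di).
exact: tvec_of_id.
Qed.

Lemma tangent_comb p (c : R) (u v : tvec M) : tangent p u -> tangent p v ->
  tangent p (fun i => c *: u i + v i).
Proof.
move=> tu tv; split=> [i di|i j di dj]; first by rewrite tu.1// tv.1// scaler0 addr0.
by rewrite -tmapE tmap_trans_lin// -!tangent_trans.
Qed.

Lemma tangent0 p : tangent p (0 : tvec M).
Proof.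
split=> // i j di dj; rewrite -[(0 : tvec M) j]/0 -[(0 : tvec M) i]/0.
by rewrite derive0.
Qed.

Lemma tangentB p (u v : tvec M) : tangent p u -> tangent p v -> tangent p (u - v).
Proof.
move=> tu tv; have := tangent_comb (-1) tv tu; congr tangent.
by apply/funext => i; rewrite scaleN1r addrC.
Qed.

End TangentVectors.

Arguments chart_image_open {R n M} i {W} _.

(** * The metric and the Levi-Civita connection in a chart *)

Section ChartMetric.
Context {R : realType} {n : nat} {M : riemannian R n}.
Implicit Types (i j : chart M) (p : M).

Lemma metric0l p (v : tvec M) : tangent p v -> metric p 0 v = 0.
Proof.
move=> tv; have := metric_linear 1 (tangent0 p) (tangent0 p) tv.
rewrite (_ : (fun i => _) = 0); last by apply/funext => i; rewrite scaler0 addr0.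
rewrite mul1r; move: (metric p 0 v) => y; lra.
Qed.

(** The metric is linear on tangent vectors only, so the induction has to carry the tangency of the
    partial sums. *)
Lemma metric_suml p (v : tvec M) (I : Type) (r : seq I) (c : I -> R) (w : I -> tvec M) :
  tangent p v -> (forall a, tangent p (w a)) ->
  tangent p (fun i => \sum_(a <- r) c a *: w a i) /\
  metric p (fun i => \sum_(a <- r) c a *: w a i) v = \sum_(a <- r) c a * metric p (w a) v.
Proof.
move=> tv tw; elim: r => [|a r [IH1 IH2]].
  rewrite big_nil (_ : (fun i => _) = 0).
    by split; [exact: tangent0|exact: metric0l].
  by apply/funext => i; rewrite big_nil.
rewrite (_ : (fun i => _) = (fun i => c a *: w a i + \sum_(a <- r) c a *: w a i)).
  split; first exact: tangent_comb.
  by rewrite metric_linear// IH2 big_cons.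
by apply/funext => i; rewrite big_cons.
Qed.

Lemma tangent_basis p (u : tvec M) i : dom i p -> tangent p u ->
  u = (fun k => \sum_a (u i) ord0 a *: tvec_of i (delta_mx ord0 a) p k).
Proof.
move=> di tu.
have te a : tangent p (tvec_of i (delta_mx ord0 a) p) by exact: tvec_of_tangent.
have [tr _] := metric_suml (index_enum _) (fun a => (u i) ord0 a) tu te.
apply: (tangent_inj tu tr di); rewrite [LHS]row_sum; apply: eq_bigr => a _.
by rewrite tvec_of_id.
Qed.

Lemma gramE i p a b : dom i p -> gram i (phi i p) a b =
  metric p (tvec_of i (delta_mx ord0 a) p) (tvec_of i (delta_mx ord0 b) p).
Proof. by move=> dp; rewrite /gram /gram_of mxE (phiK dp). Qed.

Lemma metric_chart p (u v : tvec M) i : dom i p -> tangent p u -> tangent p v ->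
  metric p u v = inner (gram i (phi i p)) (u i) (v i).
Proof.
move=> di tu tv.
have te a : tangent p (tvec_of i (delta_mx ord0 a) p) by exact: tvec_of_tangent.
rewrite [in LHS](tangent_basis di tu).
have [_ ->] := metric_suml (index_enum _) (fun a => (u i) ord0 a) tv te.
rewrite inner_mx -mulmxA mxE; apply: eq_bigr => a _; congr (_ * _).
rewrite (Defs.metric_sym (te a) tv) [in LHS](tangent_basis di tv).
have [_ ->] := metric_suml (index_enum _) (fun a => (v i) ord0 a) (te a) te.
rewrite mxE; apply: eq_bigr => b _; rewrite mulrC; congr (_ * _); last by rewrite mxE.
by rewrite (gramE _ _ di) (Defs.metric_sym (te b) (te a)).
Qed.

Lemma gram_sym i x : (phi i @` dom i) x -> (gram i x)^T = gram i x.
Proof.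
move=> [p dp <-]; apply/matrixP => a b.
rewrite mxE !(gramE _ _ dp).
by apply: Defs.metric_sym; exact: tvec_of_tangent.
Qed.

Lemma gram_pos i x u : (phi i @` dom i) x -> u <> 0 -> 0 < inner (gram i x) u u.
Proof.
move=> [p dp <-] u0.
have tu := tvec_of_tangent u dp.
have := metric_chart dp tu tu; rewrite tvec_of_id// => <-.
apply: metric_pos => // e; apply: u0.
by rewrite -(tvec_of_id u dp) e.
Qed.

Lemma gram_unit i x : (phi i @` dom i) x -> gram i x \in unitmx.
Proof.
move=> ix; rewrite -row_free_unit -kermx_eq0; apply/eqP/row_matrixP => a.
rewrite row0; apply: contrapT => /eqP r0.
have := gram_pos ix (elimN eqP r0).
have k0 : row a (kermx (gram i x)) *m gram i x = 0.
  by apply/eqP; rewrite -sub_kermx row_sub.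
by rewrite inner_mx k0 mul0mx mxE ltxx.
Qed.

Lemma gram_smooth k i : Ck_on k (phi i @` dom i) (gram i).
Proof.
apply/Ck_mxP; first exact: cod_open.
by move=> a b; exact: metric_smooth.
Qed.

Lemma dgram_smooth k i l a b : Ck_on k (phi i @` dom i) (fun x => dgram i x l a b).
Proof.
apply: (Ck_derive (f := fun y => gram i y a b)).
exact: ((Ck_mxP _ _ (cod_open i)).1 (gram_smooth k.+1 i) a b).
Qed.

Lemma christoffel_smooth k i c a b :
  Ck_on k (phi i @` dom i) (fun x => christoffel i x c a b).
Proof.
have oc := cod_open i; apply: CkM => //; first exact: Ck_cst.
apply: Ck_sum => // l; apply: CkM => //.
  by apply: (Ck_mxP _ _ oc).1; apply: Ck_invmx => //; [exact: gram_unit|exact: gram_smooth].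
apply: CkD => //; last by apply: CkN => //; exact: dgram_smooth.
by apply: CkD => //; exact: dgram_smooth.
Qed.

Lemma christoffel_form_smooth k i u v :
  Ck_on k (phi i @` dom i) (fun x => christoffel_form i x u v).
Proof.
have oc := cod_open i; apply/Ck_mxP => // r c.
apply: (@Ck_eq _ _ _ _ _
  (fun x => \sum_a \sum_b christoffel i x c a b * u ord0 a * v ord0 b)) => //.
  by move=> x _; rewrite mxE.
apply: Ck_sum => // a; apply: Ck_sum => // b.
by do 2![apply: CkM => //; try exact: Ck_cst]; exact: christoffel_smooth.
Qed.

Lemma christoffel_form_bilin i x : bilin (christoffel_form i x).
Proof.
split=> [v c u u'|u c v v']; apply/rowP => k; rewrite !mxE mulr_sumr -big_split/=;
  apply: eq_bigr => a _; rewrite mulr_sumr -big_split/=;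
  apply: eq_bigr => b _; rewrite !mxE; ring.
Qed.

Lemma dgram_sym i x l a b : (phi i @` dom i) x -> dgram i x l a b = dgram i x l b a.
Proof.
move=> ix; apply: near_eq_derive; near=> y.
have iy : (phi i @` dom i) y.
  by near: y; apply: open_nbhs_nbhs; split=> //; exact: cod_open.
by rewrite -[in LHS](gram_sym iy) mxE.
Unshelve. all: by end_near. Qed.

Lemma christoffel_sym i x k a b : (phi i @` dom i) x ->
  christoffel i x k a b = christoffel i x k b a.
Proof.
move=> ix; congr (_ * _); apply: eq_bigr => l _.
by rewrite (dgram_sym l a b ix) (addrC (dgram i x a b l)).
Qed.

(** Lowering the index cancels the inverse Gram matrix and leaves the Christoffel symbols of the
    first kind. *)
Lemma christoffel_lower i x c a b : (phi i @` dom i) x ->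
  \sum_k christoffel i x k a b * gram i x k c =
  2^-1 * (dgram i x a b c + dgram i x b a c - dgram i x c a b).
Proof.
move=> ix; set L := fun l => dgram i x a b l + dgram i x b a l - dgram i x l a b.
have -> : \sum_k christoffel i x k a b * gram i x k c =
    \sum_k (2^-1 * \sum_l (gram i x c k * invmx (gram i x) k l) * L l).
  apply: eq_bigr => k _; rewrite -[in LHS](gram_sym ix) [_^T k c]mxE /christoffel -!mulrA.
  congr (_ * _); rewrite mulr_suml; apply: eq_bigr => l _.
  by rewrite -/(L l) mulrC mulrA.
rewrite -mulr_sumr exchange_big/=; congr (_ * _).
have e l : \sum_k gram i x c k * invmx (gram i x) k l = (c == l)%:R.
  have := mulmxV (gram_unit ix); move/matrixP/(_ c l); by rewrite !mxE.
under eq_bigr do rewrite -mulr_suml e.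
rewrite (bigD1 c)//= eqxx mul1r big1 ?addr0// => l lc.
by rewrite eq_sym (negPf lc) mul0r.
Qed.

Lemma chart_inner_christoffel i x u v w : (phi i @` dom i) x ->
  inner (gram i x) (christoffel_form i x u v) w =
  \sum_a \sum_b \sum_c u ord0 a * v ord0 b * w ord0 c *
    (2^-1 * (dgram i x a b c + dgram i x b a c - dgram i x c a b)).
Proof.
move=> ix; rewrite inner_mx mxE.
under eq_bigr do rewrite mxE mulr_suml.
under [RHS]eq_bigr do rewrite exchange_big.
rewrite [RHS]exchange_big/=; apply: eq_bigr => c _; rewrite mxE.
under eq_bigr do rewrite mxE.
rewrite -mulr_suml; under [in LHS]eq_bigr do rewrite mulr_suml.
rewrite exchange_big/= mulr_suml; apply: eq_bigr => a _.
under eq_bigr do rewrite mulr_suml.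
rewrite exchange_big/= mulr_suml; apply: eq_bigr => b _.
rewrite -(christoffel_lower _ _ _ ix) !mulr_sumr mulr_suml.
apply: eq_bigr => k _; ring.
Qed.

(** Compatibility is the identity [ab,c] + [ac,b] = d_a g_bc for symbols of the first kind; the
    symmetry of the Gram matrix makes the other derivatives cancel. *)
Lemma chart_local_metric i :
  local_metric (phi i @` dom i) (gram i) (christoffel_form i).
Proof.
split; [exact: cod_open|exact: gram_sym|exact: gram_pos|exact: (gram_smooth ^~ i)
  |exact: christoffel_form_bilin| |by move=> *; exact: christoffel_form_smooth|].
  move=> x u v ix; apply/rowP => k; rewrite !mxE exchange_big/=.
  apply: eq_bigr => a _; apply: eq_bigr => b _; rewrite christoffel_sym//; ring.
move=> x u v w ix.
rewrite (inner_sym v _ (gram_sym ix)).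
rewrite (chart_inner_christoffel u v w ix) (chart_inner_christoffel u w v ix).
have oc := cod_open i.
have dg a b : is_derive x u (fun y => gram i y a b) (\sum_l u ord0 l * dgram i x l a b).
  have h := (Ck_mxP _ _ oc).1 (gram_smooth 1 i) a b.
  rewrite -(derive_sum_C1 oc ix h); apply: derivableP; exact: Ck_derivable h ix.
have -> : (fun y => inner (gram i y) v w) =
    \sum_a (\sum_b (fun y => (v ord0 a * w ord0 b) *: gram i y a b)).
  apply/funext => y; rewrite fct_sumE inner_mx -mulmxA mxE; apply: eq_bigr => a _.
  rewrite fct_sumE mxE mulr_sumr; apply: eq_bigr => b _; rewrite [w^T _ _]mxE.
  rewrite -[RHS]/(_ * _); ring.
have [_ ->] : is_derive x u (\sum_a (\sum_b (fun y => (v ord0 a * w ord0 b) *: gram i y a b)))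
    (\sum_a (\sum_b (v ord0 a * w ord0 b) *: \sum_l u ord0 l * dgram i x l a b)).
  by apply: is_derive_sum => a; apply: is_derive_sum => b; apply: is_deriveZ.
under [X in _ = _ + X]eq_bigr do rewrite exchange_big.
rewrite -big_split/=.
transitivity (\sum_c \sum_a \sum_b u ord0 c * v ord0 a * w ord0 b * dgram i x c a b).
  rewrite [RHS]exchange_big/=; apply: eq_bigr => a _.
  rewrite [RHS]exchange_big/=; apply: eq_bigr => b _.
  rewrite -[LHS]/(_ * _) mulr_sumr; apply: eq_bigr => c _; ring.
apply: eq_bigr => a _; rewrite -big_split/=; apply: eq_bigr => b _.
rewrite -big_split/=; apply: eq_bigr => c _.
rewrite (dgram_sym a c b ix) (dgram_sym c a b ix); by field.
Qed.

End ChartMetric.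

(** * Changes of charts *)

Section ChartChange.
Context {R : realType} {n : nat} {M : riemannian R n}.
Implicit Types (i j : chart M) (p : M).

Lemma local_metric_sub m (O U : set 'rV[R]_m) G Gam : open U -> U `<=` O ->
  local_metric O G Gam -> local_metric U G Gam.
Proof.
move=> oU UO LM; split=> //.
- by move=> x /UO; exact: lm_sym LM _.
- by move=> x u /UO; exact: lm_pos LM _ _.
- by move=> k; exact: Ck_sub UO (lm_smooth LM k).
- exact: lm_bilin LM.
- by move=> x u v /UO; exact: lm_torsion LM _ _ _.
- by move=> k u v; exact: Ck_sub UO (lm_conn_smooth LM k u v).
- by move=> x u v w /UO; exact: lm_compat LM _ _ _ _.
Qed.

(* A change of charts is a Riemannian submersion with trivial fibres; hence
   covariant derivatives transform as tangent vectors. *)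
Lemma trans_local_submersion i j :
  local_submersion (phi i @` (dom i `&` dom j)) (gram i) (christoffel_form i)
    (phi j @` dom j) (gram j) (christoffel_form j) (trans i j) (fun=> 1%:M).
Proof.
have oW := chart_image_open i (dom_open j).
have LM : local_metric (phi i @` (dom i `&` dom j)) (gram i) (christoffel_form i).
  by apply: local_metric_sub (chart_local_metric i) => //; exact: chart_image_sub.
split.
- exact: LM.
- exact: chart_local_metric.
- by move=> x [p [di dj] <-]; rewrite transE//; exists p.
- by move=> k; exact: trans_smooth.
- move=> x y [p [di dj] <-]; exists (tmap (trans j i) (phi j p) y).
  by rewrite tmap_trans_comp// tmap_trans_id.
- exact: Ck_cst.
- by move=> x u _; rewrite mulmx1.
- move=> x u [p [di dj] <-] z; rewrite mulmx1 transE//.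
  have tu := tvec_of_tangent u di; have tz := tvec_of_tangent z di.
  have := metric_chart dj tu tz; rewrite (metric_chart di tu tz).
  by rewrite !tvec_ofE// !tmap_trans_id.
Qed.

End ChartChange.

Section CovariantDerivative.
Context {R : realType} {n : nat} {M : riemannian R n}.
Implicit Types (i j : chart M) (p : M).

Lemma covder_unique m (Gam : 'rV[R]_m -> 'rV[R]_m -> 'rV[R]_m -> 'rV[R]_m)
    (c c' V V' : R -> 'rV[R]_m) s v y y' :
  covder Gam c v V s 1 y -> covder Gam c' v V' s 1 y' ->
  c s = c' s -> (\forall t \near s, V t = V' t) -> y = y'.
Proof.
move=> [_ e] [_ e'] cc VV; move: e; rewrite (near_eq_derive _ VV) e' cc.
by rewrite (nbhs_singleton VV) => /addIr.
Qed.

Section Along.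
Context {J : set R} {q : R -> M} {V : R -> tvec M} {i : chart M}.
Hypothesis oJ : open J.
Hypothesis Jq : forall s, J s -> dom i (q s).
Hypothesis q_smooth : forall k, Ck_on k J (phi i \o q).

Lemma velocity_smooth k : Ck_on k J (fun s => velocity q s i).
Proof.
apply: (@Ck_eq _ _ _ _ _ ('D_1 (phi i \o q))) => //; last exact: Ck_derive (q_smooth k.+1).
move=> s Js; by rewrite /velocity at_point_in ?derive1E//; exact: Jq.
Qed.

Lemma velocity_is_derive s : J s -> is_derive s 1 (phi i \o q) (velocity q s i).
Proof.
move=> Js; rewrite /velocity at_point_in; last exact: Jq.
by rewrite derive1E; apply: derivableP; exact: Ck_derivable (q_smooth 1) Js.
Qed.

Hypothesis V_smooth : forall k, Ck_on k J (fun s => V s i).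

Lemma covD_covder s : J s ->
  covder (christoffel_form i) (phi i \o q) (velocity q s i) (fun t => V t i) s 1
    (covD q V s i).
Proof.
move=> Js; rewrite /covder /covD at_point_in; last exact: Jq.
rewrite addrK derive1E; apply: derivableP; exact: Ck_derivable (V_smooth 1) Js.
Qed.

Lemma covD_smooth k : Ck_on k J (fun s => covD q V s i).
Proof.
have Jc s : J s -> (phi i @` dom i) ((phi i \o q) s) by move=> Js; exists (q s) => //; exact: Jq.
apply: (@Ck_eq _ _ _ _ _ (fun s => 'D_1 (fun t => V t i) s +
    christoffel_form i ((phi i \o q) s) (velocity q s i) (V s i))) => //.
  by move=> s Js; rewrite /covD at_point_in ?derive1E//; exact: Jq.
apply: CkD => //; first exact: Ck_derive (V_smooth k.+1).
apply: (@Ck_bilin _ _ _ _ _ _ _ _ (fun s => christoffel_form i ((phi i \o q) s))) => //.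
- by move=> s _; exact: christoffel_form_bilin.
- move=> y z; exact: (Ck_comp_mx oJ (cod_open i) Jc (q_smooth k) (christoffel_form_smooth k i y z)).
- exact: velocity_smooth.
Qed.

End Along.

Lemma curve_chart_open (I : set R) (q : R -> M) (W : set M) : open I ->
  (forall t, I t -> {for t, continuous q}) -> open W -> open (I `&` q @^-1` W).
Proof.
move=> oI qc oW; rewrite openE => t [It Wt]; rewrite /interior.
apply: filterI; first by apply: open_nbhs_nbhs.
by apply: (qc t It); apply: open_nbhs_nbhs.
Qed.

Lemma velocity_trans (I : set R) (q : R -> M) t i j : open I -> smooth_curve I q ->
  I t -> dom i (q t) -> dom j (q t) ->
  velocity q t j = tmap (trans i j) (phi i (q t)) (velocity q t i).
Proof.
move=> oI [qc qs] It di dj.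
have oJ := curve_chart_open oI qc (dom_open i).
have d1 : is_derive t 1 (phi i \o q) (velocity q t i).
  by apply: (velocity_is_derive (J := I `&` q @^-1` dom i)) => // [s []//|k]; exact: qs.
have [_ e] := is_derive_comp_diff d1 (trans_differentiable di dj).
rewrite /velocity at_point_in// derive1E tmapE -e; apply: near_eq_derive.
have : \forall s \near t, (I `&` q @^-1` dom i) s by apply: open_nbhs_nbhs; split.
by apply: filterS => s [_ /= ds]; rewrite transE.
Qed.

(** For a transition map every vector is horizontal, so its second fundamental form vanishes by
    [sff_hor] and its differential commutes with covariant differentiation. This is the
    transformation law between two charts. *)
Lemma covD_velocity_tangent (I : set R) (q : R -> M) t : open I -> smooth_curve I q ->
  I t -> tangent (q t) (covD q (velocity q) t).
Proof.
move=> oI sq It; split=> [i di|i j di dj]; first exact: at_point_out.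
rewrite -tmapE; have [qc qs] := sq.
pose J := I `&` q @^-1` (dom i `&` dom j).
have oJ : open J by apply: curve_chart_open => //; apply: openI; exact: dom_open.
have Ji s : J s -> dom i (q s) by case=> _ [].
have Jj s : J s -> dom j (q s) by case=> _ [].
have Jt : J t by [].
have qi k : Ck_on k J (phi i \o q) by apply: Ck_sub (qs i k) => s [? []].
have qj k : Ck_on k J (phi j \o q) by apply: Ck_sub (qs j k) => s [? []].
have ci := covD_covder Ji (velocity_smooth oJ Ji qi) Jt.
have cj := covD_covder Jj (velocity_smooth oJ Jj qj) Jt.
have LS := trans_local_submersion i j.
have hall x u : (phi i @` (dom i `&` dom j)) x ->
    hor_in_chart (gram i) (gram j) (trans i j) x u.
  by move=> xW; have := ls_hor LS u xW; rewrite mulmx1.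
have nJ : \forall s \near t, J s by apply: open_nbhs_nbhs.
have JW s : J s -> (phi i @` (dom i `&` dom j)) ((phi i \o q) s).
  by move=> Js; exists (q s) => //; split; [exact: Ji|exact: Jj].
have nW : \forall s \near t, (phi i @` (dom i `&` dom j)) ((phi i \o q) s).
  by apply: filterS nJ.
have := tmap_covder (gam := christoffel_form j) (ls_src LS) (ls_smooth LS) nW
  (velocity_is_derive Ji qi Jt) ci.
rewrite (sff_hor LS (JW _ Jt))//; try by apply: hall; exact: JW.
rewrite addr0 /= -(velocity_trans oI sq It di dj) => ck.
apply: covder_unique cj ck _ _; first by rewrite /= transE.
apply: filterS nJ => s Js; apply: velocity_trans oI sq _ (Ji _ Js) (Jj _ Js).
by case: Js.
Qed.

Lemma curvature_chart p (u v w : tvec M) i : dom i p ->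
  curvature p u v w i = curv (christoffel_form i) (phi i p) (u i) (v i) (w i).
Proof.
move=> di; rewrite /curvature at_point_in// /curvature_field /nabla /curv !tmapE.
have dc (z : 'rV[R]_n) (y u' : 'rV[R]_n) : 'D_u' (fun=> z) y = 0 by exact: derive_cst.
have e z z' : (fun y : 'rV[R]_n => 'D_z (fun=> z') y + christoffel_form i y z z') =
    (fun y : 'rV[R]_n => christoffel_form i y z z').
  by apply/funext => y; rewrite dc add0r.
have -> : lie_coord (fun=> u i) (fun=> v i) (phi i p) = 0.
  by rewrite /lie_coord !dc subrr.
rewrite !e !dc (lin0 ((christoffel_form_bilin i _).1 _)) addr0 subr0.
rewrite !add0r; move: ('D_(u i) _ _) ('D_(v i) _ _) => a b.
row_abel.
Qed.

(** Changing charts adds to the derivative of one field along the other a Hessian of the transition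
    map; being symmetric, it cancels in the bracket. *)
Lemma lie_tangent (U : set M) (X Y : M -> tvec M) p : open U -> U p ->
  smooth_field U X -> smooth_field U Y -> tangent p (lie X Y p).
Proof.
move=> oU Up [tX sX] [tY sY]; split=> [i di|i j di dj]; first exact: at_point_out.
rewrite -tmapE /lie !at_point_in//.
have oiU := chart_image_open i oU; have ojU := chart_image_open j oU.
have LS := trans_local_submersion i j.
have LM := ls_src LS.
have piU : (phi i @` (dom i `&` U)) (phi i p) by exists p.
have pjU : (phi j @` (dom j `&` U)) (phi j p) by exists p.
have W : (phi i @` (dom i `&` dom j)) (phi i p) by exists p.
have key (Z T : M -> tvec M) : smooth_field U Z -> tangent p (T p) ->
    'D_(T (psi j (phi j p)) j) (fun x : 'rV[R]_n => Z (psi j x) j) (phi j p) =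
    hess (trans i j) (phi i p) (T p i) (Z p i) +
    tmap (trans i j) (phi i p) ('D_(T p i) (fun x : 'rV[R]_n => Z (psi i x) i) (phi i p)).
  move=> [tZ sZ] tT; rewrite phiK//.
  have dT := trans_is_derive (T p i) di dj.
  have dZ : differentiable (fun x : 'rV[R]_n => Z (psi j x) j) (trans i j (phi i p)).
    by rewrite transE//; exact: differentiable_C1_mx ojU pjU (sZ j 1).
  have [_] := is_derive_comp_diff dT dZ; rewrite transE// -(tangent_trans tT di dj) => <-.
  have dZi : is_derive (phi i p) (T p i) (fun x : 'rV[R]_n => Z (psi i x) i)
      ('D_(T p i) (fun x : 'rV[R]_n => Z (psi i x) i) (phi i p)).
    by apply: derivableP; exact: Ck_derivable (sZ i 1) piU.
  have nW : \forall x \near phi i p, (phi i @` (dom i `&` dom j)) x.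
    exact: near_chart_image (dom_open j) di dj.
  have [_] := tmap_derive LM (ls_smooth LS) nW (is_derive_id _ (T p i)) dZi.
  rewrite /= phiK// => <-; apply: near_eq_derive.
  near=> x; have xW : (phi i @` (dom i `&` dom j)) x by near: x.
  have xU : (phi i @` (dom i `&` U)) x.
    by near: x; exact: near_chart_image oU di Up.
  have [dix djx ex] := psi_dom xW; have [_ Ux _] := psi_dom xU.
  have dt : psi j (trans i j x) = psi i x by rewrite /trans /= phiK.
  by rewrite /= dt (tangent_trans (tZ _ Ux) dix djx) ex.
rewrite /lie_coord (key Y X)//; [|exact: tX]; rewrite (key X Y)//; [|exact: tY].
rewrite phiK// (hess_sym LM (ls_smooth LS) (Y p i) (X p i) W).
rewrite -/(trans i j) (linB (tmap_trans_lin di dj)); row_abel.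
Unshelve. all: by end_near. Qed.

End CovariantDerivative.

(** * Submersions in charts *)

Lemma tmap_comp {R : realType} {a b c} (f : 'rV[R]_a -> 'rV[R]_b)
    (g : 'rV[R]_b -> 'rV[R]_c) (h : 'rV[R]_a -> 'rV[R]_c) x u :
  differentiable f x -> differentiable g (f x) ->
  (\forall y \near x, h y = g (f y)) -> tmap h x u = tmap g (f x) (tmap f x u).
Proof.
move=> df dg e.
have du : is_derive x u f (tmap f x u) by rewrite tmapE; apply/derivableP/diff_derivable.
have [_ e2] := is_derive_comp_diff du dg.
rewrite (tmapE g) -e2 tmapE; exact: near_eq_derive.
Qed.

Section ChartSubmersion.
Context {R : realType} {m n : nat} {M : riemannian R m} {N : riemannian R n}.
Context {Pi : M -> N}.
Hypothesis RS : riemannian_submersion Pi.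

Let Pi_cont : continuous Pi. Proof. by have [[]] := RS. Qed.

Definition chart_map (i : chart M) (j : chart N) : 'rV[R]_m -> 'rV[R]_n :=
  phi j \o Pi \o psi i.

Definition chart_map_dom (i : chart M) (j : chart N) : set 'rV[R]_m :=
  phi i @` (dom i `&` Pi @^-1` dom j).

Lemma preim_open (j : chart N) : open (Pi @^-1` dom j).
Proof. by apply: open_comp (dom_open j) => x _; exact: Pi_cont. Qed.

Arguments preim_open j : clear implicits.

Lemma chart_map_dom_open i j : open (chart_map_dom i j).
Proof. exact: (chart_image_open i (preim_open j)). Qed.

Arguments chart_map_dom_open i j : clear implicits.

Section Charts.
Context {i : chart M} {j : chart N}.
Local Notation F := (chart_map i j).
Local Notation W := (chart_map_dom i j).
Let oW : open W := chart_map_dom_open i j.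

Lemma chart_mapE p : dom i p -> F (phi i p) = phi j (Pi p).
Proof. by move=> dp; rewrite /chart_map /= phiK. Qed.

Lemma chart_map_maps x : W x -> (phi j @` dom j) (F x).
Proof. by move=> [p [di dj] <-]; rewrite chart_mapE//; exists (Pi p). Qed.

Lemma chart_map_smooth k : Ck_on k W F.
Proof. by have [[_ h] _ _] := RS; exact: h. Qed.

Lemma chart_map_lin x : W x -> lin (tmap F x).
Proof. by move=> Wx; exact: tmap_lin_C1 oW Wx (chart_map_smooth 1). Qed.

Lemma chart_map_differentiable p : dom i p -> dom j (Pi p) ->
  differentiable F (phi i p).
Proof.
move=> di dj; have Wp : W (phi i p) by exists p.
exact: differentiable_C1_mx oW Wp (chart_map_smooth 1).
Qed.

Lemma near_chart_map_dom p : dom i p -> dom j (Pi p) -> \forall x \near phi i p, W x.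
Proof. by move=> di dj; apply: near_chart_image => //; exact: preim_open. Qed.

End Charts.

Lemma chart_map_trans_src p i i' j u : dom i p -> dom i' p -> dom j (Pi p) ->
  tmap (chart_map i' j) (phi i' p) u =
  tmap (chart_map i j) (phi i p) (tmap (trans i' i) (phi i' p) u).
Proof.
move=> di di' dj; rewrite -[in RHS](transE i di'); apply: tmap_comp.
- exact: trans_differentiable.
- by rewrite transE//; exact: chart_map_differentiable.
apply: filterS (near_chart_image (dom_open i) di' di) => x xW.
by have [d1 d2 e] := psi_dom xW; rewrite /chart_map /trans /= phiK.
Qed.

Lemma chart_map_trans_tgt p i j j' u : dom i p -> dom j (Pi p) -> dom j' (Pi p) ->
  tmap (chart_map i j') (phi i p) u =
  tmap (trans j j') (phi j (Pi p)) (tmap (chart_map i j) (phi i p) u).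
Proof.
move=> di dj dj'; rewrite -[in RHS](chart_mapE (j := j) di); apply: tmap_comp.
- exact: chart_map_differentiable.
- by rewrite chart_mapE//; exact: trans_differentiable.
apply: filterS (near_chart_map_dom di dj) => x xW.
by have [d1 d2 e] := psi_dom xW; rewrite /chart_map /trans /= phiK.
Qed.

(** [tangent_map] reads the vector in one arbitrarily chosen chart; the chain rule for the change of
    source chart removes this choice. *)
Lemma tangent_map_chart p v i j : tangent p v -> dom i p -> dom j (Pi p) ->
  tangent_map Pi p v j = tmap (chart_map i j) (phi i p) (v i).
Proof.
move=> tv di dj; have d0 : dom (chart_at p) p := projT2 (cid (chart_cover p)).
rewrite /tangent_map at_point_in// -tmapE (chart_map_trans_src _ di d0 dj).
by rewrite -(tangent_trans tv d0 di).
Qed.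

Lemma tangent_map_tangent p v : tangent p v -> tangent (Pi p) (tangent_map Pi p v).
Proof.
move=> tv; have [i di] := chart_cover p.
split=> [j dj|j k dj dk]; first exact: at_point_out.
rewrite -tmapE (tangent_map_chart tv di dj) (tangent_map_chart tv di dk).
exact: chart_map_trans_tgt.
Qed.

Section Charts.
Context {i : chart M} {j : chart N}.
Local Notation F := (chart_map i j).
Local Notation W := (chart_map_dom i j).
Let oW : open W := chart_map_dom_open i j.

Lemma vertical_chart p v : dom i p -> dom j (Pi p) ->
  vertical Pi p v <-> tangent p v /\ tmap F (phi i p) (v i) = 0.
Proof.
move=> di dj; split=> [[tv v0]|[tv v0]]; split=> //.
  by rewrite -tangent_map_chart// v0.
apply: (tangent_inj (tangent_map_tangent tv) (tangent0 _) dj).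
by rewrite (tangent_map_chart tv di dj) v0.
Qed.

Definition chart_jac (x : 'rV[R]_m) : 'M[R]_(m, n) :=
  \matrix_(a, b) tmap F x (delta_mx ord0 a) ord0 b.

Lemma chart_jacE x u : W x -> tmap F x u = u *m chart_jac x.
Proof.
move=> Wx; rewrite (lin_row (chart_map_lin Wx)) mulmx_sum_row; apply: eq_bigr => a _.
by congr (_ *: _); apply/rowP => b; rewrite !mxE.
Qed.

Lemma chart_jac_smooth k : Ck_on k W chart_jac.
Proof.
apply/(Ck_mxP _ _ oW) => a b.
have h : Ck_on k W ('D_(delta_mx ord0 a) F) := Ck_derive _ (chart_map_smooth k.+1).
apply: Ck_eq ((Ck_mxP _ _ oW).1 h ord0 b) => // x _.
by rewrite mxE tmapE.
Qed.

(** With row vectors, y |-> y g J^T G^-1 is the adjoint of dF for the two metrics, so this is dF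
    followed by its adjoint. For a Riemannian submersion that composite is the orthogonal projection
    to the horizontal space; the explicit formula makes its smoothness evident. *)
Definition hor_proj (x : 'rV[R]_m) : 'M[R]_m :=
  chart_jac x *m gram j (F x) *m (chart_jac x)^T *m invmx (gram i x).

Let W_cod x : W x -> (phi i @` dom i) x. Proof. exact: chart_image_sub. Qed.

Lemma hor_proj_smooth k : Ck_on k W hor_proj.
Proof.
apply: Ck_mulmx => //; last first.
  apply: Ck_invmx => //; first by move=> x /W_cod; exact: gram_unit.
  exact: Ck_sub W_cod (gram_smooth k i).
apply: Ck_mulmx => //; last by apply: Ck_tr => //; exact: chart_jac_smooth.
apply: Ck_mulmx => //; first exact: chart_jac_smooth.
exact: (Ck_comp_mx oW (cod_open j) (@chart_map_maps i j) (chart_map_smooth k) (gram_smooth k j)).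
Qed.

Lemma chart_surj x y : W x -> exists z, tmap F x z = y.
Proof.
move=> [p [di dj] <-]; have [_ /(_ p (tvec_of j y (Pi p)) (tvec_of_tangent _ dj)) [v tv e] _] := RS.
exists (v i); by rewrite -tangent_map_chart// e tvec_of_id.
Qed.

(** The inner product of c J^T G^-1 with w is c (w J)^T, which vanishes on the kernel of dF. *)
Lemma lift_horizontal p c : dom i p -> dom j (Pi p) ->
  horizontal Pi p (tvec_of i (c *m (chart_jac (phi i p))^T *m invmx (gram i (phi i p))) p).
Proof.
move=> di dj; have Wp : W (phi i p) by exists p.
have Cp := W_cod Wp.
split; first exact: tvec_of_tangent.
move=> w /(vertical_chart _ di dj)[tw w0].
rewrite (metric_chart di (tvec_of_tangent _ di) tw) tvec_of_id// inner_mx.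
rewrite -(mulmxA _ (invmx _)) mulVmx ?gram_unit// mulmx1 -mulmxA -trmx_mul.
by rewrite -chart_jacE// w0 trmx0 mulmx0 mxE.
Qed.

Lemma inner_eq_mx r (S T : 'M[R]_r) :
  (forall c d : 'rV[R]_r, inner S c d = inner T c d) -> S = T.
Proof.
move=> e; apply/matrixP => a b; have := e (delta_mx ord0 a) (delta_mx ord0 b).
by rewrite !inner_mx !trmx_delta -!rowE -!colE !mxE.
Qed.

(* With J the Jacobian and N = J^T G^-1 J, the vectors c J^T G^-1 are horizontal;
   their inner products are given by N upstairs and by N g N downstairs. *)
Lemma cometric_push x : W x ->
  gram j (F x) *m ((chart_jac x)^T *m invmx (gram i x) *m chart_jac x) = 1%:M.
Proof.
move=> Wx; have Cx := W_cod Wx; have gu := gram_unit Cx.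
move: (Wx) => [p [di dj] ex].
set D := chart_jac x; set G := gram i x; set g := gram j (F x).
set S := D^T *m invmx G *m D.
have sG : (invmx G)^T = invmx G by rewrite trmx_inv (gram_sym Cx).
have sS : S^T = S by rewrite /S !trmx_mul trmxK sG mulmxA.
have sg : g^T = g by apply: gram_sym; exact: chart_map_maps.
pose L (c : 'rV[R]_n) := c *m D^T *m invmx G.
have LL c d : inner G (L c) (L d) = inner S c d.
  rewrite !inner_mx /L -(mulmxA _ (invmx G) G) mulVmx// mulmx1 !trmx_mul trmxK sG.
  by rewrite /S !mulmxA.
have DL c : L c *m D = c *m S by rewrite /L /S !mulmxA.
(* The isometry condition on the horizontal vectors L c, whose images are c S: the form c S g S d^T
   downstairs equals c S d^T upstairs. *)
have SgS : S *m g *m S = S.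
  apply: inner_eq_mx => c d; rewrite -LL.
  have [_ _ iso] := RS.
  have hc := lift_horizontal c di dj; have hd := lift_horizontal d di dj.
  have := iso p _ _ hc hd.
  rewrite (metric_chart di hc.1 hd.1).
  rewrite (metric_chart dj (tangent_map_tangent hc.1) (tangent_map_tangent hd.1)).
  rewrite (tangent_map_chart hc.1 di dj) (tangent_map_chart hd.1 di dj).
  rewrite !(tvec_of_id _ di).
  rewrite -(chart_mapE di) ex -/D -/G -/(L c) -/(L d) !chart_jacE// -/D !DL => <-.
  by rewrite !inner_mx trmx_mul sS !mulmxA.
(* If c S = 0 then L c has norm zero, so c J^T = 0; surjectivity of dF then makes every coordinate
   of c vanish. *)
have inj (c : 'rV[R]_n) : c *m S = 0 -> c = 0.
  move=> cS; have L0 : L c = 0.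
    apply: (inner_eq0 (chart_local_metric i) Cx); rewrite LL inner_mx cS mul0mx.
    by rewrite mxE.
  have cD : c *m D^T = 0.
    by rewrite -[LHS]mulmx1 -(mulVmx gu) mulmxA -/(L c) L0 mul0mx.
  apply/rowP => b; have [z ez] := chart_surj (delta_mx ord0 b) Wx.
  have : c *m (z *m D)^T = 0 by rewrite trmx_mul mulmxA cD mul0mx.
  rewrite -chart_jacE// ez trmx_delta -colE => /matrixP/(_ ord0 ord0).
  by rewrite !mxE.
(* Injectivity lets S be cancelled on the right in S g S = S; for square matrices the one-sided
   inverse obtained is two-sided. *)
suff e : S *m g = 1%:M by apply: mulmx1C.
apply/eqP; rewrite -subr_eq0; apply/eqP/row_matrixP => a; rewrite row0.
by apply: inj; rewrite -row_mul mulmxBl SgS mul1mx subrr row0.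
Qed.

Lemma tmap_hor_proj x u : W x -> tmap F x (u *m hor_proj x) = tmap F x u.
Proof.
move=> Wx; rewrite !chart_jacE// /hor_proj -!mulmxA; congr (_ *m _).
by rewrite (mulmxA _^T) cometric_push// mulmx1.
Qed.

Lemma submersion_chart : local_submersion W (gram i) (christoffel_form i)
  (phi j @` dom j) (gram j) (christoffel_form j) F hor_proj.
Proof.
split.
- exact: local_metric_sub oW W_cod (chart_local_metric i).
- exact: chart_local_metric.
- exact: chart_map_maps.
- exact: chart_map_smooth.
- by move=> x y Wx; exact: chart_surj.
- exact: hor_proj_smooth.
- exact: tmap_hor_proj.
- move=> x u Wx z; rewrite tmap_hor_proj// !chart_jacE// !inner_mx /hor_proj.
  rewrite !mulmxA -(mulmxA _ (invmx _)) mulVmx ?gram_unit//; last exact: W_cod.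
  by rewrite mulmx1 trmx_mul !mulmxA.
Qed.

Lemma hor_horizontal p u : dom i p -> dom j (Pi p) ->
  hor_in_chart (gram i) (gram j) F (phi i p) u -> horizontal Pi p (tvec_of i u p).
Proof.
move=> di dj hu; have tu := tvec_of_tangent u di; split=> // w /(vertical_chart _ di dj)[tw w0].
by rewrite (metric_chart di tu tw) tvec_of_id// hu w0 inner0r.
Qed.

(** The vertical remainder d of v under [hor_proj] is orthogonal to v by assumption and to the
    projected vector since dF d = 0; hence d is orthogonal to itself. *)
Lemma horizontal_hor p v : dom i p -> dom j (Pi p) -> horizontal Pi p v ->
  hor_in_chart (gram i) (gram j) F (phi i p) (v i).
Proof.
move=> di dj [tv hv]; have Wp : W (phi i p) by exists p.
have LS := submersion_chart.
pose d := v i - v i *m hor_proj (phi i p).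
have td := tvec_of_tangent d di.
have Fd : tmap F (phi i p) d = 0 by exact: (vert_part_vert LS).
have vd : vertical Pi p (tvec_of i d p).
  by apply/(vertical_chart _ di dj); split=> //; rewrite tvec_of_id.
have := hv _ vd; rewrite (metric_chart di tv td) tvec_of_id// => e.
have hP : hor_in_chart (gram i) (gram j) F (phi i p) (v i *m hor_proj (phi i p)).
  exact: (ls_hor LS).
have d0 : d = 0.
  apply: (inner_eq0 (ls_src LS) Wp); rewrite {1}/d innerDl innerNl e (hP d) Fd inner0r.
  by rewrite subrr.
by move/eqP: d0; rewrite subr_eq0 => /eqP ->.
Qed.

End Charts.

(** The definition would fall back on the default 0 if no decomposition existed; z minus its image
    under [hor_proj] provides one. *)
Lemma vertical_partP p z : tangent p z ->
  vertical Pi p (vertical_part Pi p z) /\ horizontal Pi p (z - vertical_part Pi p z).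
Proof.
move=> tz; have [i di] := chart_cover p; have [j dj] := chart_cover (Pi p).
have Wp : chart_map_dom i j (phi i p) by exists p.
have LS := submersion_chart (i := i) (j := j).
pose h := tvec_of i (z i *m hor_proj (i := i) (j := j) (phi i p)) p.
have th : tangent p h by exact: tvec_of_tangent.
apply: (xgetPex 0 (P := [set w : tvec M | vertical Pi p w /\ horizontal Pi p (z - w)])).
exists (z - h); split.
  apply/(vertical_chart _ di dj); split; first exact: tangentB.
  rewrite -[(z - h) i]/(z i - h i) /h tvec_of_id//; exact: (vert_part_vert LS).
rewrite opprB addrC subrK; apply: (hor_horizontal di dj); exact: (ls_hor LS).
Qed.

End ChartSubmersion.

Arguments preim_open {R m n M N Pi} RS j.
Arguments chart_map_dom_open {R m n M N Pi} RS i j.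

(** * The vertical bracket *)

Section VerticalBracket.
Context {R : realType} {m n : nat} {M : riemannian R m} {N : riemannian R n}.
Context {Pi : M -> N}.
Hypothesis RS : riemannian_submersion Pi.
Context {i : chart M} {j : chart N}.
Local Notation F := (chart_map (Pi := Pi) i j).
Local Notation W := (chart_map_dom (Pi := Pi) i j).
Local Notation om := (sff_inner (Gam := christoffel_form i) (g := gram j)
  (gam := christoffel_form j) (F := F)).

Let LS : local_submersion W (gram i) (christoffel_form i) (phi j @` dom j)
  (gram j) (christoffel_form j) F (hor_proj (Pi := Pi) (i := i) (j := j)).
Proof. exact: submersion_chart. Qed.

(** Constant components in the chart, made horizontal by projection at every point. It witnesses
    that horizontal extensions exist, so that [vertical_bracket] is not its default value. *)
Definition basic_field (u : 'rV[R]_m) (p : M) : tvec M :=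
  tvec_of i (u *m hor_proj (Pi := Pi) (i := i) (j := j) (phi i p)) p.

Lemma basic_field_extension p v : dom i p -> dom j (Pi p) -> horizontal Pi p v ->
  horizontal_extension Pi p v (dom i `&` Pi @^-1` dom j) (basic_field (v i)).
Proof.
move=> di dj hv; have oU : open (dom i `&` Pi @^-1` dom j).
  by apply: openI; [exact: dom_open|exact: (preim_open RS j)].
have Wp q : dom i q -> dom j (Pi q) -> W (phi i q) by exists q.
split=> //.
- split=> [q [dq _]|k r]; first exact: tvec_of_tangent.
  have oV := chart_image_open k oU.
  have VW x : (phi k @` (dom k `&` (dom i `&` Pi @^-1` dom j))) x -> W (trans k i x).
    by move=> [q [dk [dq dq']] <-]; rewrite transE//; exact: Wp.
  have VI x : (phi k @` (dom k `&` (dom i `&` Pi @^-1` dom j))) x ->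
      (phi i @` (dom i `&` dom k)) (trans k i x).
    by move=> [q [dk [dq dq']] <-]; rewrite transE//; exists q.
  have sT l : Ck_on l (phi k @` (dom k `&` (dom i `&` Pi @^-1` dom j))) (trans k i).
    by apply: Ck_sub (trans_smooth l k i) => x [q [dk [dq _]] <-]; exists q.
  (* Smoothness is required in every chart k: the components there are read in chart i and carried
     over by the differential of the transition map. *)
  apply: (@Ck_eq _ _ _ _ _ (fun x => tmap (trans i k) (trans k i x)
     (v i *m hor_proj (Pi := Pi) (i := i) (j := j) (trans k i x)))) => //.
    move=> x xV; have [dk _ ex] := psi_dom xV.
    by rewrite /basic_field tvec_ofE// /trans.
  apply: (@Ck_lin _ _ _ _ _ _ _ (fun x => tmap (trans i k) (trans k i x))) => //.
  + move=> x /VI [q [dq dk] e]; rewrite -e; exact: tmap_trans_lin.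
  + move=> z; apply: (Ck_comp_mx oV (chart_image_open i (dom_open k)) VI (sT r)
      (g := fun y => tmap (trans i k) y z)).
    apply: (@Ck_eq _ _ _ _ _ ('D_z (trans i k))) => //.
    * exact: (chart_image_open i (dom_open k)).
    * by move=> x _; rewrite tmapE.
    * exact: Ck_derive (trans_smooth r.+1 i k).
  + apply: Ck_mulmx => //; first exact: Ck_cst.
    exact: (Ck_comp_mx oV (chart_map_dom_open RS i j) VW (sT r) (hor_proj_smooth RS r)).
- move=> q [dq dq']; apply: (hor_horizontal RS dq dq'); exact: (ls_hor LS _ (Wp _ dq dq')).
- apply: (tangent_inj (tvec_of_tangent _ di) hv.1 di); rewrite tvec_of_id//.
  by rewrite (hor_fix LS (Wp _ di dj))//; exact: (horizontal_hor RS di dj hv).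
Qed.

(** Along a straight line with velocity v the field Y is horizontal, so [hor_covder] applies; for
    vertical u it leaves om(v,u,w) = om(u,v,w), which depends only on the values at p. *)
Lemma horizontal_field_derive p v w U X Y u : dom i p -> dom j (Pi p) ->
  horizontal_extension Pi p v U X -> horizontal_extension Pi p w U Y ->
  tmap F (phi i p) u = 0 ->
  inner (gram i (phi i p)) ('D_(v i) (fun x => Y (psi i x) i) (phi i p)
     + christoffel_form i (phi i p) (v i) (w i)) u = om (phi i p) u (v i) (w i).
Proof.
move=> di dj [oU Up sX hX Xp] [_ _ [tY sY] hY Yp] u0.
have Wp : W (phi i p) by exists p.
pose c (t : R) := phi i p + t *: v i.
have c0 : c 0 = phi i p by rewrite /c scale0r addr0.
have dc : is_derive (0 : R) 1 c (v i).
  by apply: (@is_derive_line R _ _ id _ (v i) 0 (v i)); exact: (is_derive_id _ (v i)).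
have oUi := chart_image_open i oU.
have Wc : W (c 0) by rewrite c0.
have Uc : (phi i @` (dom i `&` U)) (c 0) by rewrite c0; exists p.
have dV := is_derive_comp_C1 oUi Uc (sY i 1) dc.
have cV : covder (christoffel_form i) c (v i) (fun t => Y (psi i (c t)) i) 0 1
    ('D_(v i) (fun x => Y (psi i x) i) (c 0) + christoffel_form i (c 0) (v i) (Y (psi i (c 0)) i)).
  by rewrite /covder addrK.
have nh : \forall t \near (0 : R),
    hor_in_chart (gram i) (gram j) F (c t) (Y (psi i (c t)) i).
  near=> t.
  have Wt : W (c t) by near: t; exact: (near_open_derive (chart_map_dom_open RS i j) Wc dc).
  have Ut : (phi i @` (dom i `&` U)) (c t) by near: t; exact: (near_open_derive oUi Uc dc).
  have [dit Upt e] := psi_dom Ut; have [_ djt _] := psi_dom Wt.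
  by rewrite -[X in hor_in_chart _ _ _ X]e; exact: (horizontal_hor RS dit djt (hY _ Upt)).
have := hor_covder LS u Wc dc cV nh.
rewrite c0 phiK// Yp u0 inner0r subr0 => <-.
rewrite /om u0 inner0r add0r; congr inner.
exact: (sff_sym (ls_src LS) (ls_tgt LS) (ls_maps LS) (ls_smooth LS)).
Unshelve. all: by end_near. Qed.

(** The connection is torsion free, so the bracket is nabla_X Y - nabla_Y X; its vertical part pairs
    to om(u,v,w) - om(u,w,v), and antisymmetry doubles the first term. The extensions have
    disappeared from the result. *)
Lemma lie_vertical p v w U X Y u : dom i p -> dom j (Pi p) ->
  horizontal_extension Pi p v U X -> horizontal_extension Pi p w U Y ->
  tmap F (phi i p) u = 0 ->
  inner (gram i (phi i p)) (lie X Y p i) u = 2 * om (phi i p) u (v i) (w i).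
Proof.
move=> di dj eX eY u0; have Wp : W (phi i p) by exists p.
have hv : horizontal Pi p v by have [_ Up _ h <-] := eX; exact: h.
have hw : horizontal Pi p w by have [_ Up _ h <-] := eY; exact: h.
have e1 := horizontal_field_derive di dj eX eY u0.
have e2 := horizontal_field_derive di dj eY eX u0.
have e3 := om_anti LS u Wp (horizontal_hor RS di dj hv) (horizontal_hor RS di dj hw).
have [_ _ _ _ Xp] := eX; have [_ _ _ _ Yp] := eY.
rewrite /lie at_point_in// /lie_coord phiK// Xp Yp innerDl innerNl.
move: e1 e2 e3; rewrite !innerDl.
rewrite (lm_torsion (ls_src LS) (w i) (v i) Wp).
move: (inner _ _ _) (inner _ _ _) (inner _ _ _) (om _ _ _ _) (om _ _ _ _) => a b d e f.
by move=> *; lra.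
Qed.

(** [xget] picks an unspecified pair of extensions, and [lie_vertical] evaluates the bracket for
    whichever pair it is; [basic_field] ensures that there is one. *)
Lemma vertical_bracketP p v w : dom i p -> dom j (Pi p) ->
  horizontal Pi p v -> horizontal Pi p w ->
  vertical Pi p (vertical_bracket Pi p v w) /\
  forall u, vertical Pi p u ->
    metric p (vertical_bracket Pi p v w) u = 2 * om (phi i p) (u i) (v i) (w i).
Proof.
move=> di dj hv hw.
have := xgetPex 0 (P := [set z : tvec M | exists U X Y,
    [/\ horizontal_extension Pi p v U X, horizontal_extension Pi p w U Y
      & z = vertical_part Pi p (lie X Y p)]]).
rewrite -/(vertical_bracket Pi p v w); case.
  exists (vertical_part Pi p (lie (basic_field (v i)) (basic_field (w i)) p)).
  exists (dom i `&` Pi @^-1` dom j), (basic_field (v i)), (basic_field (w i)).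
  by split=> //; exact: basic_field_extension.
move=> U [X [Y [eX eY ->]]].
have [oU Up sX _ _] := eX; have [_ _ sY _ _] := eY.
have tl : tangent p (lie X Y p) := lie_tangent oU Up sX sY.
have [vz [hz hz0]] := vertical_partP RS tl.
split=> // u vu; have := hz0 u vu.
have [tu u0] := (vertical_chart RS u di dj).1 vu.
rewrite (metric_chart di hz tu) (metric_chart di vz.1 tu).
rewrite -[(_ - _) i]/(lie X Y p i - vertical_part Pi p (lie X Y p) i) innerDl innerNl.
rewrite (lie_vertical di dj eX eY u0) => /eqP; rewrite subr_eq0 => /eqP ->.
exact: erefl.
Qed.

(** For the converse the bracket, being vertical, is tested against itself, and positivity of the
    metric applies. *)
Lemma vertical_bracket_eq0 p v w : dom i p -> dom j (Pi p) ->
  horizontal Pi p v -> horizontal Pi p w ->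
  vertical_bracket Pi p v w = 0 <->
  forall z, tmap F (phi i p) z = 0 -> om (phi i p) z (v i) (w i) = 0.
Proof.
move=> di dj hv hw; have [vb eb] := vertical_bracketP di dj hv hw.
split=> [b0 z z0|h].
  have vz : vertical Pi p (tvec_of i z p).
    by apply/(vertical_chart RS _ di dj); rewrite tvec_of_id//; split=> //; exact: tvec_of_tangent.
  have := eb _ vz; rewrite b0 metric0l; last exact: vz.1.
  by rewrite tvec_of_id// => /esym/eqP; rewrite mulf_eq0 pnatr_eq0 => /eqP.
apply: contrapT => nb.
have := Defs.metric_pos vb.1 nb; rewrite eb//.
have [_ b0] := (vertical_chart RS _ di dj).1 vb.
by rewrite h// mulr0 ltxx.
Qed.

End VerticalBracket.

(** * Cubics and horizontal lifts *)

Section HorizontalLift.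
Context {R : realType} {m n : nat} {M : riemannian R m} {N : riemannian R n}.
Context {Pi : M -> N} {I : set R} {q : R -> N} {qt : R -> M}.
Hypothesis RS : riemannian_submersion Pi.
Hypothesis oI : open I.
Hypothesis cq : riemannian_cubic I q.
Hypothesis lift : horizontal_lift Pi I q qt.

Let sqt : smooth_curve I qt. Proof. by case: lift. Qed.
Let qtE t : I t -> Pi (qt t) = q t. Proof. by case: lift => _ + _; apply. Qed.
Let hqt t : I t -> horizontal Pi (qt t) (velocity qt t).
Proof. by case: lift => _ _; apply. Qed.
Let sq : smooth_curve I q. Proof. by case: cq. Qed.

Section Charts.
Context {i : chart M} {j : chart N}.
Local Notation F := (chart_map (Pi := Pi) i j).
Local Notation W := (chart_map_dom (Pi := Pi) i j).
Local Notation om := (sff_inner (Gam := christoffel_form i) (g := gram j)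
  (gam := christoffel_form j) (F := F)).

(** All assertions are local in t, so one pair of charts suffices near each parameter; openness of
    this set allows identities that hold on it to be differentiated. *)
Definition lift_dom : set R := I `&` qt @^-1` (dom i `&` Pi @^-1` dom j).
Local Notation J := lift_dom.

Let LS : local_submersion W (gram i) (christoffel_form i) (phi j @` dom j)
  (gram j) (christoffel_form j) F (hor_proj (Pi := Pi) (i := i) (j := j)).
Proof. exact: submersion_chart. Qed.

Let oJ : open J.
Proof.
apply: curve_chart_open oI sqt.1 _.
by apply: openI; [exact: dom_open|exact: (preim_open RS j)].
Qed.

Let JI s : J s -> I s. Proof. by case. Qed.
Let Ji s : J s -> dom i (qt s). Proof. by case=> _ []. Qed.
Let Jj' s : J s -> dom j (Pi (qt s)). Proof. by case=> _ []. Qed.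
Let Jj s : J s -> dom j (q s).
Proof. by move=> Js; rewrite -(qtE (JI Js)); exact: Jj'. Qed.

Let nJ s : J s -> \forall t \near s, J t.
Proof. by move=> Js; exact: open_nbhs_nbhs. Qed.

Let c := phi i \o qt.
Let v t := velocity qt t i.
Let a t := covD qt (velocity qt) t i.
Let b t := covD qt (covD qt (velocity qt)) t i.
Let Db t := iter 3 (covD qt) (velocity qt) t i.

Let JW s : J s -> W (c s).
Proof. by move=> Js; exists (qt s) => //; split; [exact: Ji|exact: Jj']. Qed.

Let c_smooth k : Ck_on k J c.
Proof. by apply: Ck_sub (sqt.2 i k) => s Js; split; [exact: JI|exact: Ji]. Qed.

Let q_smooth k : Ck_on k J (phi j \o q).
Proof. by apply: Ck_sub (sq.2 j k) => s Js; split; [exact: JI|exact: Jj]. Qed.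

Let v_smooth k : Ck_on k J v. Proof. exact: velocity_smooth oJ Ji c_smooth k. Qed.
Let a_smooth k : Ck_on k J a. Proof. exact: covD_smooth oJ Ji c_smooth v_smooth k. Qed.
Let b_smooth k : Ck_on k J b. Proof. exact: covD_smooth oJ Ji c_smooth a_smooth k. Qed.

Let dc s : J s -> is_derive s 1 c (v s).
Proof. exact: velocity_is_derive Ji c_smooth s. Qed.
Let dv s : J s -> covder (christoffel_form i) c (v s) v s 1 (a s).
Proof. exact: covD_covder Ji v_smooth s. Qed.
Let da s : J s -> covder (christoffel_form i) c (v s) a s 1 (b s).
Proof. exact: covD_covder Ji a_smooth s. Qed.
Let db s : J s -> covder (christoffel_form i) c (v s) b s 1 (Db s).
Proof. exact: covD_covder Ji b_smooth s. Qed.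

Let hv s : J s -> hor_in_chart (gram i) (gram j) F (c s) (v s).
Proof. by move=> Js; exact: (horizontal_hor RS (Ji Js) (Jj' Js) (hqt (JI Js))). Qed.

Let ha s : J s -> hor_in_chart (gram i) (gram j) F (c s) (a s).
Proof. exact: (acc_hor LS oJ JW dc dv hv). Qed.

Let Fc s : J s -> F (c s) = phi j (q s).
Proof. by move=> Js; rewrite /c /= chart_mapE ?qtE//; [exact: JI|exact: Ji]. Qed.

Lemma acc_horizontal s : J s -> horizontal Pi (qt s) (covD qt (velocity qt) s).
Proof.
move=> Js; have ta := covD_velocity_tangent oI sqt (JI Js).
rewrite -(tvec_of_tangentE (Ji Js) ta).
exact: (hor_horizontal RS (Ji Js) (Jj' Js) (ha Js)).
Qed.

Let velE s : J s -> velocity q s j = tmap F (c s) (v s).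
Proof.
move=> Js; have [_ <-] := velocity_is_derive Jj q_smooth Js.
have [_ <-] := base_derive LS JW dc Js.
by apply: near_eq_derive; apply: filterS (nJ Js) => t Jt; rewrite /= -Fc.
Qed.

(** The curve q and the chart expression F of the lift agree only on J; covariant derivatives depend
    on germs, which is enough to transfer them from one to the other. *)
Let baseE (V : R -> tvec N) (Z : R -> 'rV[R]_m) s y :
  (forall k, Ck_on k J (fun t => V t j)) ->
  (forall t, J t -> V t j = tmap F (c t) (Z t)) -> J s ->
  covder (christoffel_form j) (F \o c) (tmap F (c s) (v s)) (fun t => tmap F (c t) (Z t)) s 1 y ->
  covD q V s j = y.
Proof.
move=> sV e Js dy; have := covD_covder Jj sV Js; rewrite velE// => dV.
apply: covder_unique dV dy _ _; first by rewrite /= -Fc.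
exact: filterS (nJ Js).
Qed.

Let qv_smooth k : Ck_on k J (fun t => velocity q t j).
Proof. exact: velocity_smooth oJ Jj q_smooth k. Qed.
Let qa_smooth k : Ck_on k J (fun t => covD q (velocity q) t j).
Proof. exact: covD_smooth oJ Jj q_smooth qv_smooth k. Qed.
Let qb_smooth k : Ck_on k J (fun t => covD q (covD q (velocity q)) t j).
Proof. exact: covD_smooth oJ Jj q_smooth qa_smooth k. Qed.

Let accE s : J s -> covD q (velocity q) s j = tmap F (c s) (a s).
Proof.
by move=> Js; apply: (baseE qv_smooth velE Js); exact: (base_vel LS oJ JW dc dv hv Js).
Qed.

Let jerkE s : J s -> covD q (covD q (velocity q)) s j = tmap F (c s) (b s).
Proof.
by move=> Js; apply: (baseE qa_smooth accE Js); exact: (base_acc LS oJ JW dc dv da hv Js).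
Qed.

(** The velocity, acceleration and jerk of q are the images of v, a and b; at the third derivative
    B(v,b) appears, which is why [base_cubic] has that shape. *)
Let base_cubic0 s : J s -> base_cubic (Gam := christoffel_form i)
  (gam := christoffel_form j) (F := F) (c := c) (v := v) (a := a) (b := b) (Db := Db) s = 0.
Proof.
move=> Js; have [_ /(_ s (JI Js))] := cq.
move=> /(congr1 (fun z : tvec N => z j)).
rewrite -[LHS]/(iter 3 (covD q) (velocity q) s j + curvature (q s)
   (covD q (velocity q) s) (velocity q s) (velocity q s) j).
rewrite (curvature_chart _ _ _ (Jj Js)) (accE Js) (velE Js) -(Fc Js).
rewrite -[iter 3 _ _ _ _]/(covD q (covD q (covD q (velocity q))) s j).
by rewrite (baseE qb_smooth jerkE Js (base_jerk LS oJ JW dc db Js)).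
Qed.

Let cubicE s : J s ->
  (iter 3 (covD qt) (velocity qt) s + curvature (qt s) (covD qt (velocity qt) s)
    (velocity qt s) (velocity qt s)) i =
  cubic (Gam := christoffel_form i) (c := c) (v := v) (a := a) (Db := Db) s.
Proof.
move=> Js; rewrite -[LHS]/(iter 3 (covD qt) (velocity qt) s i + curvature (qt s)
   (covD qt (velocity qt) s) (velocity qt s) (velocity qt s) i).
by rewrite (curvature_chart _ _ _ (Ji Js)).
Qed.

Let bracketE s : J s ->
  vertical_bracket Pi (qt s) (velocity qt s) (covD qt (velocity qt) s) = 0 <->
  forall z, tmap F (c s) z = 0 -> om (c s) z (v s) (a s) = 0.
Proof.
move=> Js; exact: (vertical_bracket_eq0 RS (Ji Js) (Jj' Js) (hqt (JI Js)) (acc_horizontal Js)).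
Qed.

Lemma lift_cubic_bracket s : J s -> riemannian_cubic I qt ->
  vertical_bracket Pi (qt s) (velocity qt s) (covD qt (velocity qt) s) = 0.
Proof.
move=> Js [_ /(_ s (JI Js)) e]; apply/(bracketE Js) => z _.
apply: (cubic_om0 LS oJ JW dc dv da hv z Js (base_cubic0 Js)).
by rewrite -cubicE// e.
Qed.

Lemma lift_bracket_cubic s : J s ->
  (forall t, I t ->
    vertical_bracket Pi (qt t) (velocity qt t) (covD qt (velocity qt) t) = 0) ->
  (iter 3 (covD qt) (velocity qt) s + curvature (qt s) (covD qt (velocity qt) s)
    (velocity qt s) (velocity qt s)) i = 0.
Proof.
move=> Js h; rewrite cubicE//.
apply: (om0_cubic LS oJ JW dc dv da db hv Js (base_cubic0 Js)) => t Jt.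
by apply/(bracketE Jt); exact: h (JI Jt).
Qed.

End Charts.
End HorizontalLift.

Unset Implicit Arguments.

Theorem theorem5p4 (R : realType) (m n : nat)
    (Qt : riemannian R m) (Q : riemannian R n) (Pi : Qt -> Q)
    (I : set R) (q : R -> Q) (qt : R -> Qt) :
  riemannian_submersion Pi ->
  open I -> is_interval I ->
  riemannian_cubic I q ->
  horizontal_lift Pi I q qt ->
  riemannian_cubic I qt <->
  (forall t, I t ->
     vertical_bracket Pi (qt t) (velocity qt t) (covD qt (velocity qt) t) = 0).
Proof.
move=> RS oI _ cq lift; split=> [cqt t It|h].
  have [i di] := chart_cover (qt t); have [j dj] := chart_cover (Pi (qt t)).
  by apply: (lift_cubic_bracket (i := i) (j := j) RS oI cq lift).
split=> [|t It]; first by case: lift.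
(* The equation is one of families indexed by all charts; in the charts that do not contain the
   point both summands are 0 by the convention of [at_point]. *)
apply/funext => i; have [di|di] := pselect (dom i (qt t)).
  have [j dj] := chart_cover (Pi (qt t)).
  by apply: (lift_bracket_cubic (i := i) (j := j) RS oI cq lift).
rewrite -[LHS]/(covD qt _ t i + curvature (qt t) _ _ _ i) /covD /curvature.
by rewrite !(at_point_out _ di) addr0.
Qed.
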